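(* Let $T\ge 0$ and $y(\cdot)\in L^2([-r,T];Z)$. Then the function $t\mapsto Fy_t$ belongs to $L^2([0,T];X)$. Moreover, there exists a constant $C>0$ (independent of $y$) such that $$\int_0^T\|Fy_t\|_X^2\,dt\le C\int_{-r}^T\|y(t)\|_Z^2\,dt .$$
   Context: $X$ is a separable real Banach space with norm $\|\cdot\|_X$, $A:\mathscr D(A)\subset X\to X$ generates a strongly continuous semigroup on $X$, and $Z$ is a Banach space with norm $\|\cdot\|_Z$ such that $\mathscr D(A)\hookrightarrow Z\hookrightarrow X$ with dense and continuous injections. Let $r\ge 0$. The operator $F:C([-r,0];Z)\to X$ is bounded, linear, and has the representation $$F\varphi=\int_{-r}^0 d\eta(\theta)\varphi(\theta),\qquad \varphi\in C([-r,0];Z),$$ where $\eta:[-r,0]\to\mathscr L(Z,X)$ (bounded linear operators from $Z$ to $X$) is of bounded variation. The segment $y_t$ is defined by $y_t(\theta)=y(t+\theta)$, $\theta\in[-r,0]$, $t\ge 0$. For $y\in C([-r,T];Z)$ the function $t\mapsto Fy_t$ is defined pointwise on $[0,T]$; for $y\in L^2([-r,T];Z)$ it is understood through the continuous extension of the linear map $y\mapsto (t\mapsto Fy_t)$ from the dense subspace $C([-r,T];Z)$ of $L^2([-r,T];Z)$ to $L^2([-r,T];Z)$, with values in $L^2([0,T];X)$. *)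

(* Defs.v *)
From HB Require Import structures.
From mathcomp Require Import all_boot all_order all_algebra.
From mathcomp Require Import all_classical all_reals all_analysis.

Set Implicit Arguments.
Unset Strict Implicit.
Unset Printing Implicit Defensive.

Import Order.TTheory GRing.Theory Num.Theory.
Import numFieldNormedType.Exports.

Local Open Scope classical_set_scope.
Local Open Scope ring_scope.

Definition separable (X : topologicalType) : Prop :=
  exists2 Q : set X, countable Q & dense Q.

Section Semigroups.
Context {R : realType} {X : completeNormedModType R}.

(* Only the values [S t] with [0 <= t] are relevant. *)
Definition C0_semigroup (S : R -> {linear X -> X}) : Prop :=
  [/\ forall t, 0 <= t -> continuous (S t),
      forall x, S 0 x = x,
      forall s t x, 0 <= s -> 0 <= t -> S (s + t) x = S s (S t x) &
      forall x, S t x @[t --> 0^'+] --> x].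

Definition difference_quotient (S : R -> {linear X -> X}) (x : X) (h : R) : X :=
  h^-1 *: (S h x - x).

(* An unbounded operator is given by its domain [DA] and a total function [A]
   whose values outside of [DA] are irrelevant. *)
Definition generates_C0_semigroup (DA : set X) (A : X -> X) : Prop :=
  exists S : R -> {linear X -> X},
    [/\ C0_semigroup S,
        DA = [set x | cvg (difference_quotient S x h @[h --> 0^'+])] &
        forall x, DA x -> difference_quotient S x h @[h --> 0^'+] --> A x].

End Semigroups.

Section Embeddings.
Context {R : realType} {X Z : completeNormedModType R}.

(* D(A) --> Z --> X with continuous dense injections; [iota] is the injection
   of Z into X and D(A) carries the graph norm |x| + |A x|. *)
Definition dense_continuous_embeddings (DA : set X) (A : X -> X)
    (iota : {linear Z -> X}) : Prop :=
  [/\ injective iota, continuous iota & dense (range iota)] /\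
  [/\ DA `<=` range iota,
      exists c : R, forall z, DA (iota z) ->
        `|z| <= c * (`|iota z| + `|A (iota z)|) &
      dense (iota @^-1` DA)].

End Embeddings.

Section ContinuousFunctions.
Context {R : realType} {X Z : completeNormedModType R}.

(* A function on [a, b] is represented by a function on R, of which only the
   restriction to [a, b] matters. *)
Definition continuous_on (a b : R) (f : R -> Z) : Prop :=
  {within `[a, b], continuous f}.

Definition sup_norm (a b : R) (f : R -> Z) : R :=
  sup [set `|f t| | t in `[a, b]].

Definition bounded_linear_on_C (a b : R) (F : (R -> Z) -> X) : Prop :=
  (forall (k : R) (f g : R -> Z), continuous_on a b f -> continuous_on a b g ->
     F (fun t => k *: f t + g t) = k *: F f + F g) /\
  (exists M : R, forall f, continuous_on a b f -> `|F f| <= M * sup_norm a b f).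

Definition segment (y : R -> Z) (t : R) : R -> Z := fun theta => y (t + theta).

End ContinuousFunctions.

Section OperatorStieltjes.
Context {R : realType} {X Z : completeNormedModType R}.
Implicit Types (a b : R) (eta : R -> {linear Z -> X}) (s : seq R).

Definition opnorm (L : Z -> X) : R := sup [set `|L z| | z in [set z | `|z| <= 1]].

(* The library encodes a partition [a = p_0 < ... < p_(size s) = b] as the
   list [s] of the nodes [p_1, ..., p_(size s)]. *)
Definition node a b s (n : nat) : R := nth b (a :: s) n.

Definition increment a b eta s (n : nat) : Z -> X :=
  fun z => eta (node a b s n.+1) z - eta (node a b s n) z.

Definition op_variation a b eta s : R :=
  \sum_(0 <= n < size s) opnorm (increment a b eta s n).

Definition op_bounded_variation a b eta : Prop :=
  has_ubound [set op_variation a b eta s | s in itv_partition a b].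

Definition tagged_mesh a b s (xi : nat -> R) (delta : R) : Prop :=
  forall n : nat, (n < size s)%N ->
    node a b s n <= xi n <= node a b s n.+1 /\
    node a b s n.+1 - node a b s n < delta.

(* [v] is the Riemann-Stieltjes integral of [phi] over [a, b] against [eta]. *)
Definition is_stieltjes_integral a b eta (phi : R -> Z) (v : X) : Prop :=
  forall e : R, 0 < e -> exists2 delta : R, 0 < delta &
    forall s xi, itv_partition a b s -> tagged_mesh a b s xi delta ->
      `|\sum_(0 <= n < size s) increment a b eta s n (phi (xi n)) - v| < e.

End OperatorStieltjes.

Section L2.
Context {R : realType}.
Local Notation mu := (@lebesgue_measure R).

Section Space.
Context {V : completeNormedModType R}.

Definition simple_function (f : R -> V) : Prop :=
  finite_set (range f) /\ forall v, measurable (f @^-1` [set v]).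

Definition strongly_measurable (a b : R) (f : R -> V) : Prop :=
  exists2 s : nat -> R -> V, forall n, simple_function (s n) &
    \forall t \ae mu, t \in `[a, b] -> s n t @[n --> \oo] --> f t.

(* The integral is an extended real; [f] is only measurable with respect to
   the completed measure, but the integral of a nonnegative function does not
   see null sets. *)
Definition L2_sqnorm (a b : R) (f : R -> V) : \bar R :=
  (\int[mu]_(t in `[a, b]) (`|f t| ^+ 2)%:E)%E.

(* Elements of L^2([a, b]; V) are handled through representatives, equality
   being almost everywhere on [a, b]. *)
Definition L2 (a b : R) (f : R -> V) : Prop :=
  strongly_measurable a b f /\ (L2_sqnorm a b f < +oo)%E.

Definition L2_eq (a b : R) (f g : R -> V) : Prop :=
  \forall t \ae mu, t \in `[a, b] -> f t = g t.

Definition L2_cvg (a b : R) (u : nat -> R -> V) (f : R -> V) : Prop :=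
  L2_sqnorm a b (fun t => u n t - f t) @[n --> \oo] --> 0%E.

End Space.

Context {X Z : completeNormedModType R}.

(* [Phi] is a continuous linear map from L^2([-r, T]; Z) to L^2([0, T]; X)
   that extends [y |-> (t |-> F y_t)] from C([-r, T]; Z). Continuity applied to
   constant sequences makes [Phi] compatible with equality almost everywhere. *)
Definition L2_extension (r T : R) (F : (R -> Z) -> X)
    (Phi : (R -> Z) -> (R -> X)) : Prop :=
  [/\ forall y, L2 (- r) T y -> L2 0 T (Phi y),
      forall (k : R) y1 y2, L2 (- r) T y1 -> L2 (- r) T y2 ->
        L2_eq 0 T (Phi (fun t => k *: y1 t + y2 t))
                  (fun t => k *: Phi y1 t + Phi y2 t),
      forall (u : nat -> R -> Z) y, (forall n, L2 (- r) T (u n)) ->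
        L2 (- r) T y -> L2_cvg (- r) T u y ->
        L2_cvg 0 T (fun n => Phi (u n)) (Phi y) &
      forall y, continuous_on (- r) T y ->
        L2_eq 0 T (Phi y) (fun t => F (segment y t))].

End L2.

(* Main.v *)
Require Import Defs.
From HB Require Import structures.
From mathcomp Require Import all_boot all_order all_algebra.
From mathcomp Require Import all_classical all_reals all_analysis.
From mathcomp Require Import measurable_realfun ring lra.

(* For continuous [y], the Riemann-Stieltjes sums of [F y_t] are
   [\sum_k L_k (y (t + xi_k))] with [\sum_k |L_k| <= V], [V] the variation of
   [eta]. The weighted Cauchy-Schwarz inequality and the invariance of the
   Lebesgue measure under the translations by [xi_k] bound their squared L^2
   norm on [0, T] by [V ^ 2] times that of [y] on [-r, T], and Fatou's lemma
   carries the bound to [F y_t]. Since continuous functions are dense in L^2,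
   [Phi y] is the a.e. limit of [t |-> F (u_n)_t] along continuous [u_n] that
   converge fast to [y] in L^2; Fatou's lemma again gives
   [|Phi y - F v_t|^2 <= 2 C |y - v|^2] for all continuous [v], which implies all
   the claims. *)

Set Implicit Arguments.
Unset Strict Implicit.
Unset Printing Implicit Defensive.

Import Order.TTheory GRing.Theory Num.Theory.
Import numFieldNormedType.Exports.

Local Open Scope classical_set_scope.
Local Open Scope ring_scope.

(** For [y] in L^2 the segments need not be continuous and nothing is known about [F] on them, so
    [Phi y] has no formula and must be a limit. Riemann sums take the place of Fubini's theorem for
    the variation measure of [eta]: each sum is a finite combination of translates of [y]. Strong
    measurability allows exceptional null sets, hence the integrands of [L2_sqnorm] are measurable
    only up to null sets; integrals are therefore compared as lower integrals, and Borel
    representatives of the norms serve wherever measurability is required. Squared norms are kept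
    throughout, with [2 x^2 + 2 y^2] in place of Minkowski's inequality, which is the origin of the
    factor 2 in front of [C]. Approximation uses functions continuous on all of R, whose segments
    are continuous at every time; composition with [clamp] reduces functions continuous only on
    [[- r, T]] to these. *)

Section LowerIntegral.
Context d (T : measurableType d) (R : realType) (mu : {measure set T -> \bar R}).
Import HBNNSimple.
Local Open Scope ereal_scope.

(** Without measurability the integral is the supremum over simple functions below the integrand.
    Cutting such a function to 0 on the null set [N] keeps its integral and places it below [g]. *)
Lemma ae_ge0_le_integral (D : set T) (f g : T -> \bar R) :
  (forall x, D x -> 0 <= f x) -> (forall x, D x -> 0 <= g x) ->
  {ae mu, forall x, D x -> f x <= g x} ->
  \int[mu]_(x in D) f x <= \int[mu]_(x in D) g x.
Proof.
move=> f0 g0 [N [mN muN0 subN]].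
rewrite !(integral_mkcond D) !ge0_integralTE; last 2 first.
- by move=> x; apply: erestrict_ge0.
- by move=> x; apply: erestrict_ge0.
apply/ge_ereal_sup => _ [/= h hf <-].
pose k := proj_nnsfun h (measurableC mN).
have -> : sintegral mu h = sintegral mu k.
  rewrite -!integralT_nnsfun; apply: ge0_ae_eq_integral => //.
  - exact/measurable_EFinP.
  - exact/measurable_EFinP.
  - by move=> x _; rewrite lee_fin.
  - by move=> x _; rewrite lee_fin.
  exists N; split => // x /= hk; apply: contrapT => Nx; apply: hk => _.
  by rewrite mindicE mem_set ?mulr1.
apply: ereal_sup_ubound; exists k => // x /=; rewrite mindicE.
have [|_] := boolP (x \in ~` N); last first.
  by rewrite mulr0; apply: erestrict_ge0.
rewrite inE => Nx; rewrite mulr1 (le_trans (hf x))//.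
rewrite /patch; case: ifPn => //; rewrite inE => Dx.
by apply: contrapT => fg; apply: Nx; apply: subN => /(_ Dx).
Qed.

Lemma ae_ge0_eq_integral (D : set T) (f g : T -> \bar R) :
  (forall x, D x -> 0 <= f x) -> (forall x, D x -> 0 <= g x) ->
  {ae mu, forall x, D x -> f x = g x} ->
  \int[mu]_(x in D) f x = \int[mu]_(x in D) g x.
Proof.
move=> f0 g0 fg; apply/eqP; rewrite eq_le; apply/andP; split;
  apply: ae_ge0_le_integral => //;
  by apply: filterS fg => x fg /fg ->.
Qed.

Lemma ge0_le_integral_subset (D E : set T) (f : T -> \bar R) :
  D `<=` E -> (forall x, E x -> 0 <= f x) ->
  \int[mu]_(x in D) f x <= \int[mu]_(x in E) f x.
Proof.
move=> DE f0; rewrite (integral_mkcond D) (integral_mkcond E).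
apply: ae_ge0_le_integral.
- by move=> x _; apply: erestrict_ge0 => y /DE /f0.
- by move=> x _; apply: erestrict_ge0.
apply: aeW => x _; rewrite /patch; case: ifPn => [|_].
  by rewrite inE => /DE Ex; rewrite mem_set.
by case: ifPn => //; rewrite inE => /f0.
Qed.

End LowerIntegral.

(** * Strong measurability and the L^2 seminorm *)

Section LebesgueAE.
Context {R : realType}.
Local Notation mu := (@lebesgue_measure R).
Implicit Types P Q S : R -> Prop.

Lemma ae_imply P Q : (forall t, P t -> Q t) ->
  (\forall t \ae mu, P t) -> \forall t \ae mu, Q t.
Proof. by move=> PQ; apply: filterS; first exact: (ae_filter_ringOfSetsType mu). Qed.

Lemma ae_imply2 P Q S : (forall t, P t -> Q t -> S t) ->
  (\forall t \ae mu, P t) -> (\forall t \ae mu, Q t) -> \forall t \ae mu, S t.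
Proof. by move=> PQ; apply: filterS2; first exact: (ae_filter_ringOfSetsType mu). Qed.

End LebesgueAE.

Section SimpleFunctions.
Context {R : realType}.

(** [h] is arbitrary: a fibre of the composite is a finite union, over pairs of values, of
    intersections of fibres of [f] and [g]. *)
Lemma simple_comp2 (U V W : completeNormedModType R) (h : U -> V -> W)
    (f : R -> U) (g : R -> V) :
  simple_function f -> simple_function g ->
  simple_function (fun t => h (f t) (g t)).
Proof.
move=> [ff mf] [fg mg]; have fX := finite_setX ff fg; split.
  apply: (@sub_finite_set _ _ ((fun p => h p.1 p.2) @` (range f `*` range g))).
    by move=> _ [t _ <-]; exists (f t, g t) => //; split; exists t.
  exact: finite_image.
move=> w; pose D := (range f `*` range g) `&` [set p | h p.1 p.2 = w].
rewrite [X in measurable X](_ : _ =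
    \bigcup_(p in D) (f @^-1` [set p.1] `&` g @^-1` [set p.2])); last first.
  apply/seteqP; split => t /=.
    by move=> ht; exists (f t, g t) => //; split => //; split; exists t.
  by move=> [[p q] [_ /= hpq]] [/= -> ->].
apply: fin_bigcup_measurable; first exact: finite_setIl.
by move=> p _; exact: measurableI.
Qed.

Lemma simple_comp (U V : completeNormedModType R) (h : U -> V) (f : R -> U) :
  simple_function f -> simple_function (h \o f).
Proof. by move=> sf; have := simple_comp2 (fun u _ => h u) sf sf. Qed.

Lemma simple_measurable_fun (V : completeNormedModType R) (h : V -> R) (f : R -> V) :
  simple_function f -> measurable_fun setT (h \o f).
Proof.
move=> [ff mf] _ Y mY; rewrite setTI.
rewrite [X in measurable X](_ : _ =
    \bigcup_(v in range f `&` h @^-1` Y) f @^-1` [set v]); last first.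
  apply/seteqP; split => t /=.
    by move=> Yt; exists (f t) => //; split => //; exists t.
  by move=> [v [_ Yv]] /= ->.
by apply: fin_bigcup_measurable => //; exact: finite_setIl.
Qed.

Lemma simple_cst (V : completeNormedModType R) (v : V) :
  simple_function (fun _ : R => v).
Proof.
split; first by apply: (@sub_finite_set _ _ [set v]) => // _ [t _ <-].
move=> w; have [->|vw] := pselect (v = w).
  by rewrite [X in measurable X](_ : _ = setT)//; apply/seteqP; split.
by rewrite [X in measurable X](_ : _ = set0)//; apply/seteqP; split.
Qed.

Lemma simple_indic (B : set R) : measurable B ->
  simple_function (\1_B : R -> R).
Proof.
move=> mB; split.
  apply: (@sub_finite_set _ _ [set 0; 1]) => // _ [t _ <-] /=.
  by rewrite indicE; case: (_ \in _); [right|left].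
by move=> v; rewrite -[X in measurable X]setTI; exact: measurable_indic.
Qed.

Lemma simple_if (V : completeNormedModType R) (B : set R) (f g : R -> V) :
  measurable B -> simple_function f -> simple_function g ->
  simple_function (fun t => if t \in B then f t else g t).
Proof.
move=> mB sf sg.
have s1 := @simple_comp2 R^o V V (fun x v => x *: v) _ _ (simple_indic mB) sf.
have s2 := @simple_comp2 R^o V V (fun x v => x *: v) _ _
  (simple_indic (measurableC mB)) sg.
have := simple_comp2 +%R s1 s2; congr simple_function; apply/funext => t.
by rewrite !indicE in_setC; case: (_ \in _); rewrite scale1r scale0r ?addr0 ?add0r.
Qed.

End SimpleFunctions.

Section StronglyMeasurable.
Context {R : realType} {V : completeNormedModType R}.
Local Notation mu := (@lebesgue_measure R).
Implicit Types (a b : R) (f g : R -> V).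

Lemma simple_strongly_measurable a b f :
  simple_function f -> strongly_measurable a b f.
Proof. by move=> sf; exists (fun=> f) => //; apply: aeW => t _; exact: cvg_cst. Qed.

Lemma strongly_measurable_lin a b (k : R) f g :
  strongly_measurable a b f -> strongly_measurable a b g ->
  strongly_measurable a b (fun t => k *: f t + g t).
Proof.
move=> [s ss sf] [u su ug]; exists (fun n t => k *: s n t + u n t).
  by move=> n; exact: (simple_comp2 (fun v w => k *: v + w)).
apply: ae_imply2 sf ug => t sf ug tab.
by apply: cvgD; [apply: cvgZr; exact: sf|exact: ug].
Qed.

Lemma strongly_measurableB a b f g :
  strongly_measurable a b f -> strongly_measurable a b g ->
  strongly_measurable a b (fun t => f t - g t).
Proof.
move=> mf mg; have := strongly_measurable_lin (-1) mg mf.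
by congr strongly_measurable; apply/funext => t; rewrite scaleN1r addrC.
Qed.

(** Off the measurable null set [N] the norms [|s n t|] converge at every point of [[a, b]], so
    their limit, set to 0 elsewhere, is a Borel function. *)
Lemma strongly_measurable_norm a b f : strongly_measurable a b f ->
  exists h : R -> R, [/\ measurable_fun setT h, forall t, 0 <= h t &
    \forall t \ae mu, t \in `[a, b] -> `|f t| = h t].
Proof.
move=> [s ss [N [mN muN0 subN]]].
pose D : set R := `[a, b] `\` N.
have mD : measurable D by exact: measurableD.
exists ((fun t => `|f t|) \_ D); split.
- apply/(measurable_restrictT _ mD).
  apply: (@measurable_fun_cvg _ _ _ D (fun n t => `|s n t|)).
    by move=> n; apply: measurable_funTS; exact: (simple_measurable_fun Num.norm (ss n)).
  move=> t [tab Nt]; apply: cvg_norm.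
  by apply: contrapT => st; apply: Nt; apply: subN => /(_ tab).
- by move=> t; rewrite /patch; case: ifP.
- exists N; split => // t /= ht; apply: contrapT => Nt; apply: ht => tab.
  by rewrite /patch mem_set.
Qed.

End StronglyMeasurable.

Lemma le_limn_einf (R : realType) (u v : (\bar R)^nat) :
  (forall n, (u n <= v n)%E) -> (limn_einf u <= limn_einf v)%E.
Proof.
move=> uv; rewrite !limn_einf_lim; apply: lee_lim; try exact: is_cvg_einfs.
apply: nearW => n; apply: le_ereal_inf_tmp => _ [m /= nm <-].
by apply: le_trans (uv m); apply: ereal_inf_lbound; exists m.
Qed.

Section SquareNorm.
Context {R : realType} {V : completeNormedModType R}.
Local Notation mu := (@lebesgue_measure R).
Implicit Types (a b : R) (f g : R -> V).
Local Open Scope ereal_scope.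

Lemma L2_sqnorm_ge0 a b f : 0 <= L2_sqnorm a b f.
Proof. by apply: integral_ge0 => t _; rewrite lee_fin sqr_ge0. Qed.

Lemma le_L2_sqnorm (W : completeNormedModType R) a b f (g : R -> W) :
  (\forall t \ae mu, t \in `[a, b]%R -> (`|f t| <= `|g t|)%R) ->
  L2_sqnorm a b f <= L2_sqnorm a b g.
Proof.
move=> fg; apply: ae_ge0_le_integral.
- by move=> t _; rewrite lee_fin sqr_ge0.
- by move=> t _; rewrite lee_fin sqr_ge0.
by apply: ae_imply fg => t fg tab; rewrite lee_fin ler_sqr ?nnegrE// fg.
Qed.

Lemma eq_L2_sqnorm a b f g : L2_eq a b f g ->
  L2_sqnorm a b f = L2_sqnorm a b g.
Proof.
move=> fg; apply/eqP; rewrite eq_le; apply/andP; split;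
  by apply: le_L2_sqnorm; apply: ae_imply fg => t fg /fg ->.
Qed.

(** Supplies a Borel integrand, to which linearity of the integral, Fatou's lemma and dominated
    convergence apply. *)
Lemma L2_sqnorm_rep a b f : strongly_measurable a b f ->
  exists h : R -> R, [/\ measurable_fun setT h, forall t, (0 <= h t)%R,
    (\forall t \ae mu, t \in `[a, b]%R -> (`|f t| = h t)%R) &
    L2_sqnorm a b f = \int[mu]_(t in `[a, b]) (h t ^+ 2)%:E].
Proof.
move=> /strongly_measurable_norm[h [mh h0 fh]]; exists h; split => //.
apply: ae_ge0_eq_integral.
- by move=> t _; rewrite lee_fin sqr_ge0.
- by move=> t _; rewrite lee_fin sqr_ge0.
by apply: ae_imply fh => t fh tab; rewrite fh.
Qed.

Lemma measurable_EFin_sqr (h : R -> R) (D : set R) : measurable_fun setT h ->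
  measurable_fun D (fun t => (h t ^+ 2)%:E).
Proof.
move=> mh; apply: measurable_funTS; apply/measurable_EFinP.
exact: measurable_funX.
Qed.

Lemma L2_sqnormD a b f g :
  strongly_measurable a b f -> strongly_measurable a b g ->
  L2_sqnorm a b (fun t => f t + g t)%R <=
    2%:E * L2_sqnorm a b f + 2%:E * L2_sqnorm a b g.
Proof.
move=> /L2_sqnorm_rep[h [mh h0 fh ->]] /L2_sqnorm_rep[k [mk k0 gk ->]].
rewrite -!ge0_integralZl//; try exact: measurable_EFin_sqr; try by move=> t _; rewrite lee_fin sqr_ge0.
rewrite -ge0_integralD//.
- apply: ae_ge0_le_integral.
  + by move=> t _; rewrite lee_fin sqr_ge0.
  + by move=> t _; rewrite -!EFinM -EFinD lee_fin addr_ge0// mulr_ge0// sqr_ge0.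
  apply: ae_imply2 fh gk => t fh gk tab; rewrite -!EFinM -EFinD lee_fin.
  rewrite -fh// -gk//; apply: (@le_trans _ _ ((`|f t| + `|g t|) ^+ 2)%R).
    by rewrite ler_sqr ?nnegrE ?addr_ge0// ler_normD.
  have := sqr_ge0 (`|f t| - `|g t|)%R; lra.
- by move=> t _; rewrite -EFinM lee_fin mulr_ge0// sqr_ge0.
- by apply: measurable_funeM; exact: measurable_EFin_sqr.
- by move=> t _; rewrite -EFinM lee_fin mulr_ge0// sqr_ge0.
- by apply: measurable_funeM; exact: measurable_EFin_sqr.
Qed.

Lemma L2_sqnormZ a b (k : R) f : strongly_measurable a b f ->
  L2_sqnorm a b (fun t => k *: f t) = (k ^+ 2)%:E * L2_sqnorm a b f.
Proof.
move=> /L2_sqnorm_rep[h [mh h0 fh ->]].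
rewrite -ge0_integralZl//.
- apply: ae_ge0_eq_integral.
  + by move=> t _; rewrite lee_fin sqr_ge0.
  + by move=> t _; rewrite -EFinM lee_fin mulr_ge0// sqr_ge0.
  apply: ae_imply fh => t fh tab; rewrite -EFinM normrZ exprMn fh//.
  by rewrite real_normK ?num_real.
- exact: measurable_EFin_sqr.
- by move=> t _; rewrite lee_fin sqr_ge0.
- by rewrite lee_fin sqr_ge0.
Qed.

Lemma L2_sqnormBC a b f g :
  L2_sqnorm a b (fun t => f t - g t)%R = L2_sqnorm a b (fun t => g t - f t)%R.
Proof. by apply: eq_integral => t _; rewrite distrC. Qed.

Lemma L2_sqnorm_triangle a b f g h :
  strongly_measurable a b f -> strongly_measurable a b g ->
  strongly_measurable a b h ->
  L2_sqnorm a b (fun t => f t - h t)%R <=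
    2%:E * L2_sqnorm a b (fun t => f t - g t)%R +
    2%:E * L2_sqnorm a b (fun t => g t - h t)%R.
Proof.
move=> mf mg mh.
have := L2_sqnormD (strongly_measurableB mf mg) (strongly_measurableB mg mh).
by congr (L2_sqnorm _ _ _ <= _); apply/funext => t; rewrite addrA subrK.
Qed.

(** Fatou's lemma acts on the representatives [h n] of the norms [|u n|]; their squares converge
    a.e. to [|f|^2], which suffices for a comparison of lower integrals. *)
Lemma L2_sqnorm_fatou a b (u : nat -> R -> V) f (c : nat -> \bar R) (l : \bar R) :
  (forall n, strongly_measurable a b (u n)) ->
  (\forall t \ae mu, t \in `[a, b]%R -> u n t @[n --> \oo] --> f t) ->
  (forall n, L2_sqnorm a b (u n) <= c n) -> c n @[n --> \oo] --> l ->
  L2_sqnorm a b f <= l.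
Proof.
move=> mu_ uf uc cl.
have /choice[h hP] := fun n => L2_sqnorm_rep (mu_ n).
have mh n : measurable_fun `[a, b] (fun t => (h n t ^+ 2)%:E).
  by apply: measurable_EFin_sqr; case: (hP n).
apply: (@le_trans _ _ (\int[mu]_(t in `[a, b]) limn_einf (fun n => (h n t ^+ 2)%:E))).
  apply: ae_ge0_le_integral.
  - by move=> t _; rewrite lee_fin sqr_ge0.
  - move=> t _; apply: (@le_trans _ _ (limn_einf (fun=> 0 : \bar R))).
      by rewrite (cvg_limn_einf_sup (cvg_cst _)).1.
    by apply: le_limn_einf => n; rewrite lee_fin sqr_ge0.
  have allh : \forall t \ae mu, forall n, t \in `[a, b]%R -> (`|u n t| = h n t)%R.
    by apply: ae_foralln => n; case: (hP n).
  apply: ae_imply2 uf allh => t uf allh tab.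
  have : (h n t ^+ 2)%:E @[n --> \oo] --> (`|f t| ^+ 2)%:E.
    apply/cvg_EFin; first exact: nearW.
    rewrite [X in X @ _](_ : _ = fun n => (`|u n t| ^+ 2)%R); last first.
      by apply/funext => n /=; rewrite allh.
    by under eq_fun do rewrite expr2; rewrite expr2; apply: cvgM; apply: cvg_norm; exact: uf.
  by move=> /cvg_limn_einf_sup[-> _].
apply: (le_trans (fatou mu _ mh _)) => //.
  by move=> n t _; rewrite lee_fin sqr_ge0.
rewrite -(cvg_limn_einf_sup cl).1.
by apply: le_limn_einf => n; case: (hP n) => _ _ _ <-.
Qed.

Lemma L2_sqnorm_eq0 a b f : strongly_measurable a b f ->
  L2_sqnorm a b f = 0 -> L2_eq a b f (fun=> 0%R).
Proof.
move=> /L2_sqnorm_rep[h [mh h0 fh ->]] i0.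
have /(ae_eq_integral_abs mu)[//|+ _] : measurable_fun `[a, b] (fun t => (h t ^+ 2)%:E).
  exact: measurable_EFin_sqr.
have -> : \int[mu]_(t in `[a, b]) `|(h t ^+ 2)%:E| = 0.
  by rewrite -[RHS]i0; apply: eq_integral => t _; rewrite gee0_abs// lee_fin sqr_ge0.
move=> /(_ erefl); apply: ae_imply2 fh => t fh ht tab.
have /eqP := ht tab; rewrite eqe sqrf_eq0 => /eqP ht0.
by apply/eqP; rewrite -normr_eq0 fh// ht0.
Qed.


End SquareNorm.

(** * Uniform approximation of continuous functions by simple functions *)

Section UniformContinuity.
Context {R : realType} {V : completeNormedModType R}.
Implicit Types (a b : R) (u : R -> V).

(** Uniform continuity through compactness: around each [x], radius [d / 2] for [t] and for [h]
    keeps both [t] and [t + h] within [d] of [x]. The point [t + h] may leave [[a, b]], hence the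
    continuity on all of R. *)
Lemma continuous_shift_near a b u (e : R) : continuous u -> 0 < e ->
  \forall h \near (0 : R), forall t, t \in `[a, b] -> `|u (t + h) - u t| < e.
Proof.
move=> cu e0; have /compact_near_coveringP := @segment_compact R a b.
move=> /(_ R (nbhs (0 : R)) (fun h t => `|u (t + h) - u t| < e) _); apply => x _.
have e20 : 0 < e / 2 by rewrite divr_gt0.
have /cvgrPdist_lt/(_ _ e20) := cu x.
move=> /nbhs_ballP[/= d d0 xd]; have d20 : 0 < d / 2 by rewrite divr_gt0.
exists (ball x (d / 2), ball (0 : R) (d / 2)) => /=.
  by split; exact: nbhsx_ballx.
move=> [t h] [/= xt]; rewrite /ball/= sub0r normrN => h0.
have ut : `|u x - u t| < e / 2.
  by apply: xd; apply: le_ball xt; rewrite ler_pdivrMr// ler_peMr ?ltW// ltr1n.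
have uth : `|u x - u (t + h)| < e / 2.
  apply: xd; rewrite /ball/= opprD addrA (le_lt_trans (ler_normB _ _))//.
  by rewrite (splitr d) ltrD.
rewrite -(subrK (u x) (u (t + h))) -addrA (le_lt_trans (ler_normD _ _))//.
by rewrite (splitr e) ltrD// distrC.
Qed.

Lemma continuous_simple_approx a b u (e : R) : continuous u -> 0 < e ->
  exists2 s : R -> V, simple_function s &
    forall t, t \in `[a, b] -> `|s t - u t| < e.
Proof.
move=> cu e0.
have /nbhs_ballP[/= d d0 ud] := continuous_shift_near a b cu e0.
(* The step function grows by one interval of length [d] at a time; the count chosen below makes
   [a + k * d] exceed [b]. *)
suff step (k : nat) : exists2 s : R -> V, simple_function s &
    forall t, t \in `[a, b] -> t < a + k%:R * d -> `|s t - u t| < e.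
  have [s ss su] := step (Num.trunc ((b - a) / d)).+1.
  exists s => // t tab; apply: su => //; move: tab; rewrite in_itv/= => /andP[at_ tb].
  rewrite -ltrBlDl -ltr_pdivrMr//.
  rewrite (le_lt_trans (y := (b - a) / d))//; first by rewrite ler_pM2r ?invr_gt0// lerD2r.
  exact: truncnS_gt.
elim: k => [|k [s ss su]].
  exists (fun=> 0); first exact: simple_cst.
  by move=> t; rewrite in_itv/= mul0r addr0 ltNge => /andP[->].
exists (fun t => if t \in [set` `]-oo, a + k%:R * d[] then s t else u (a + k%:R * d)).
  by apply: simple_if => //; exact: simple_cst.
move=> t tab tk; case: ifPn => [/set_mem/=|/negP/[!inE]/=/negP];
  rewrite in_itv/=; first exact: su.
rewrite -leNgt => kt.
rewrite distrC; have -> : t = a + k%:R * d + (t - (a + k%:R * d)) by rewrite addrC subrK.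
apply: ud.
  rewrite /ball/= sub0r normrN ger0_norm ?subr_ge0// ltrBlDl.
  by move: tk; rewrite -natr1 mulrDl mul1r addrA.
move: tab; rewrite !in_itv/= => /andP[_ tb].
by rewrite (le_trans kt tb) andbT lerDl mulr_ge0// ltW.
Qed.

(** Replacing [g n] by a simple function within [1 / (n + 1)], uniformly on [[a, b]], preserves
    every pointwise limit, so no diagonal extraction occurs. *)
Lemma strongly_measurable_cvg a b (g : nat -> R -> V) (f : R -> V) :
  (forall n, continuous (g n)) ->
  (\forall t \ae (@lebesgue_measure R), t \in `[a, b] -> g n t @[n --> \oo] --> f t) ->
  strongly_measurable a b f.
Proof.
move=> cg gf.
have /choice[s sP] n : exists s : R -> V, simple_function s /\
    forall t, t \in `[a, b] -> `|s t - g n t| < n.+1%:R^-1.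
  have n0 : 0 < n.+1%:R^-1 :> R by rewrite invr_gt0 ltr0n.
  by have [s ss sg] := continuous_simple_approx a b (cg n) n0; exists s.
exists s; first by move=> n; case: (sP n).
apply: ae_imply gf => t gf tab; have {}gf := gf tab.
rewrite [X in X @ _](_ : _ = (fun n => (s n t - g n t) + g n t)); last first.
  by apply/funext => n; rewrite subrK.
rewrite -[f t]add0r; apply: cvgD => //; apply/norm_cvg0P.
apply: (@squeeze_cvgr _ _ _ _ (fun=> 0) (fun n => n.+1%:R^-1)).
- by apply: nearW => n; rewrite normr_ge0/= ltW//; case: (sP n) => _; apply.
- exact: cvg_cst.
- exact: cvg_harmonic.
Qed.

Lemma continuous_strongly_measurable a b u :
  continuous u -> strongly_measurable a b u.
Proof.
move=> cu; apply: (@strongly_measurable_cvg a b (fun=> u)) => //.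
by apply: aeW => t _; exact: cvg_cst.
Qed.

End UniformContinuity.

(** * Density of continuous functions in L^2 *)

Section Clamp.
Context {R : realType}.

(* [min (max a x) b] when [a <= b], in a form whose continuity is immediate. *)
Definition clamp (a b x : R) : R := (`|x - a| - `|x - b| + a + b) / 2.

Lemma clamp_continuous a b : continuous (clamp a b).
Proof.
move=> x; apply: cvgMl; apply: cvgD; last exact: cvg_cst.
apply: cvgD; last exact: cvg_cst.
by apply: cvgB; apply: cvg_norm; apply: cvgB;
  by [exact: cvg_id|exact: cvg_cst].
Qed.

Lemma clamp_itv a b x : a <= b -> clamp a b x \in `[a, b].
Proof.
move=> ab; rewrite in_itv/= /clamp.
have [xa|ax] := lerP x a; have [xb|bx] := lerP x b.
all: by apply/andP; split; lra.
Qed.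

Lemma clamp_id a b x : x \in `[a, b] -> clamp a b x = x.
Proof.
rewrite in_itv/= /clamp => /andP[ax xb].
by rewrite ger0_norm ?subr_ge0// ler0_norm ?subr_le0//; lra.
Qed.

(** Converts L^1 approximation of an indicator into L^2 approximation: [clamp 0 1] is nonexpansive
    and fixes 0 and 1, and a distance of at most 1 dominates its square. *)
Lemma clamp01_indic_dist (B : set R) (t x : R) :
  `|\1_B t - clamp 0 1 x| ^+ 2 <= `|\1_B t - x|.
Proof.
have := @clamp_itv 0 1 x ler01; rewrite in_itv/= => /andP[c0 c1].
apply: (@le_trans _ _ `|\1_B t - clamp 0 1 x|).
  rewrite expr2 ler_piMl// indicE; case: (_ \in _) => /=.
    by rewrite ger0_norm ?subr_ge0//; lra.
  by rewrite sub0r normrN ger0_norm.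
rewrite indicE; case: (_ \in _) => /=.
  rewrite ger0_norm ?subr_ge0// distrC /clamp subr0.
  by have [x0|x0] := ler0P x; have [x1|x1] := ler0P (x - 1); lra.
rewrite !sub0r !normrN ger0_norm// /clamp subr0.
by have [x0|x0] := ler0P x; have [x1|x1] := ler0P (x - 1); lra.
Qed.

End Clamp.

Lemma cvge0_lt (R : realType) (u : (\bar R)^nat) (e : R) : 0 < e ->
  u n @[n --> \oo] --> 0%E -> \forall n \near \oo, (u n < e%:E)%E.
Proof.
move=> e0 u0; have /u0 : nbhs (0%E : \bar R) [set x | (x < e%:E)%E].
  apply: open_nbhs_nbhs; split; first exact: open_ereal_lt_ereal.
  by rewrite /= lte_fin.
by [].
Qed.

Section Density.
Context {R : realType} {V : completeNormedModType R}.
Local Notation mu := (@lebesgue_measure R).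
Implicit Types (a b : R) (f g : R -> V).

Definition L2_approximable a b f := forall e : R, 0 < e ->
  exists2 u : R -> V, continuous u & (L2_sqnorm a b (fun t => f t - u t)%R <= e%:E)%E.

Lemma L2_approximableD a b f g :
  strongly_measurable a b f -> strongly_measurable a b g ->
  L2_approximable a b f -> L2_approximable a b g ->
  L2_approximable a b (fun t => f t + g t).
Proof.
(* [L2_sqnormD] doubles both errors, hence the quarter. *)
move=> mf mg af ag e e0; have e40 : 0 < e / 4 by rewrite divr_gt0.
have [u cu fu] := af _ e40; have [v cv gv] := ag _ e40.
exists (fun t => u t + v t); first by move=> t; apply: cvgD; [exact: cu|exact: cv].
have -> : (fun t => f t + g t - (u t + v t)) = (fun t => (f t - u t) + (g t - v t)).
  by apply/funext => t; rewrite opprD addrACA.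
have mu_ := strongly_measurableB mf (continuous_strongly_measurable a b cu).
have mv := strongly_measurableB mg (continuous_strongly_measurable a b cv).
apply: (le_trans (L2_sqnormD mu_ mv)).
apply: (@le_trans _ _ (2%:E * (e / 4)%:E + 2%:E * (e / 4)%:E)%E).
  by apply: leeD; rewrite lee_pmul2l// lte_fin.
by rewrite -!EFinM -EFinD lee_fin; lra.
Qed.

Lemma L2_approximable_indic a b (B : set R) (v : V) : measurable B ->
  L2_approximable a b (fun t => \1_B t *: v).
Proof.
move=> mB e e0.
have iB : mu.-integrable `[a, b] (EFin \o (\1_B : R -> R)).
  apply: measurable_bounded_integrable => //.
  - by apply: compact_finite_measure; exact: segment_compact.
  - exists 1; split; rewrite ?num_real// => x x1 t _.
    by rewrite /= indicE; case: (_ \in _); rewrite ?normr0 ?normr1 ltW// (lt_trans _ x1).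
have fab : (mu `[a, b] < +oo)%E by apply: compact_finite_measure; exact: segment_compact.
have [//|g [cg ig Bg]] := approximation_continuous_integrable _ fab iB.
(* The summand 1 keeps [e / c] meaningful when [v = 0]. *)
pose c := `|v| ^+ 2 + 1; have c0 : 0 < c by rewrite ltr_wpDl// sqr_ge0.
have /(cvge0_lt (divr_gt0 e0 c0))[n _ /(_ n (leqnn n)) gn] := Bg.
exists (fun t => clamp 0 1 (g n t) *: v).
  move=> t; apply: cvgZl => /=.
  by apply: (@continuous_comp _ _ _ (g n) (clamp 0 1)); [exact: cg|exact: clamp_continuous].
apply: (@le_trans _ _ (\int[mu]_(t in `[a, b]) (c%:E * `|(\1_B t - g n t)%:E|))%E).
  apply: ae_ge0_le_integral.
  - by move=> t _; rewrite lee_fin sqr_ge0.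
  - by move=> t _; rewrite mule_ge0// lee_fin ltW.
  apply: aeW => t _; rewrite -EFinM lee_fin -scalerBl normrZ exprMn mulrC.
  by rewrite ler_pM ?sqr_ge0// ?clamp01_indic_dist// lerDl.
rewrite ge0_integralZl ?lee_fin ?(ltW c0)//; last first.
  apply/measurable_EFinP; apply: measurableT_comp => //.
  apply: measurable_funB; first by apply: measurable_funTS; exact: measurable_indic.
  by apply: measurable_funTS; apply: continuous_measurable_fun; exact: cg.
apply: (@le_trans _ _ (c%:E * (e / c)%:E)%E); first by rewrite lee_pmul2l// ltW.
by rewrite -EFinM mulrC divfK ?gt_eqF.
Qed.

(** Induction on the list of values: mapping [v] to 0 removes it from the list, at the cost of one
    indicator multiple of [v]. The 0 in front of the list absorbs the removed values. *)
Lemma L2_approximable_simple a b f : simple_function f -> L2_approximable a b f.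
Proof.
move=> sf; have [/finite_seqP[l lE] _] := sf.
have {lE} : forall t, f t \in 0 :: l.
  move=> t; rewrite inE; apply/orP; right.
  by have : [set` l] (f t) by rewrite -lE; exists t.
elim: l f sf => [|v l IH] f sf fl.
  move=> e e0; exists (fun=> 0); first by move=> t; exact: cvg_cst.
  rewrite /L2_sqnorm integral0_eq ?lee_fin ?ltW// => t _.
  by have := fl t; rewrite inE => /eqP ->; rewrite subr0 normr0 expr0n.
pose h x := if x == v then 0 else x : V.
have shf : simple_function (h \o f) := simple_comp h sf.
have mv : measurable (f @^-1` [set v]) by case: sf.
have -> : f = fun t => (h \o f) t + \1_(f @^-1` [set v]) t *: v.
  apply/funext => t /=; rewrite /h indicE; case: eqP => [ftv|ftv].
    by rewrite mem_set// scale1r add0r.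
  by rewrite memNset// scale0r addr0.
apply: L2_approximableD.
- exact: simple_strongly_measurable.
- apply: simple_strongly_measurable.
  by apply: (simple_comp (fun x : R^o => x *: v)); exact: simple_indic.
- apply: IH => // t /=; rewrite /h; case: eqP => [_|ftv]; first by rewrite inE eqxx.
  by have := fl t; rewrite !inE => /or3P[->//|/eqP//|->]; rewrite orbT.
- exact: L2_approximable_indic.
Qed.

Lemma L2_simple_approx a b f (e : R) : L2 a b f -> 0 < e ->
  exists2 s : R -> V, simple_function s &
    (L2_sqnorm a b (fun t => f t - s t)%R <= e%:E)%E.
Proof.
move=> [mf foo] e0; have [s ss sf] := mf.
have [h [mh h0 fh sqfh]] := L2_sqnorm_rep mf.
(* The [s n] converge only pointwise; truncation to [A n] provides domination. The margin 1 puts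
   almost every [t] of [[a, b]] in [A n] for all large [n], even where [h t = 0]. *)
pose A n := [set t | `|s n t| <= h t + 1].
have mA n : measurable (A n).
  rewrite (_ : A n = setT `&` (fun t => `|s n t| <= h t + 1) @^-1` [set true]); last first.
    by rewrite setTI.
  apply: measurable_fun_ler => //; first exact: (simple_measurable_fun Num.norm (ss n)).
  exact: measurable_funD.
pose u n t := if t \in A n then s n t else 0.
have su n : simple_function (u n) by apply: simple_if => //; exact: simple_cst.
have /choice[k kP] n := L2_sqnorm_rep
  (strongly_measurableB mf (simple_strongly_measurable a b (su n))).
have kae : \forall t \ae mu, forall n, t \in `[a, b] -> `|f t - u n t| = k n t.
  by apply: ae_foralln => n; case: (kP n).
(* The majorant: [|f - u n| <= 2 h + 1] on both parts of the truncation, and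
   [(2 h + 1)^2 <= 8 h^2 + 2]. *)
have ig : mu.-integrable `[a, b] (fun t => (8 * (h t ^+ 2) + 2)%:E).
  rewrite (_ : (fun _ => _) =
      (fun t => (8 : R)%:E * (h t ^+ 2)%:E + (cst (2 : R) t)%:E)%E); last first.
    by apply/funext => t; rewrite -EFinM -EFinD.
  apply: integrableD => //.
    apply: integrableZl => //.
    apply/integrableP; split; first exact: measurable_EFin_sqr.
    rewrite (_ : (\int[_]_(_ in _) _)%E = L2_sqnorm a b f)// sqfh.
    by apply: eq_integral => t _; rewrite gee0_abs// lee_fin sqr_ge0.
  apply: (@measurable_bounded_integrable _ _ _ mu (cst (2 : R))) => //.
  - by apply: compact_finite_measure; exact: segment_compact.
  - exists 2; split; rewrite ?num_real// => x x2 t _ /=.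
    by rewrite ger0_norm// ltW.
have := @dominated_convergence _ _ _ mu `[a, b] _
  (fun n t => (k n t ^+ 2)%:E) (fun=> 0%E) (fun t => (8 * (h t ^+ 2) + 2)%:E).
case=> //.
- by move=> n; apply: measurable_EFin_sqr; case: (kP n).
- apply: ae_imply2 (ae_imply2 (fun t => @conj _ _) sf fh) kae.
  move=> t [st ft] kt tab.
  have ht : `|f t| = h t := ft tab.
  have : (k n t ^+ 2)%:E @[n --> \oo] --> ((0 : R) ^+ 2)%:E.
    apply/cvg_EFin; first exact: nearW.
    suff k0 : k n t @[n --> \oo] --> (0 : R).
      under eq_fun do rewrite /= expr2.
      by rewrite expr2; apply: cvgM.
    rewrite (_ : (fun n => k n t) = fun n => `|f t - u n t|); last first.
      by apply/funext => n; rewrite kt.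
    suff ut : u n t @[n --> \oo] --> f t.
      rewrite -(normr0 V) -(subrr (f t)); apply: cvg_norm.
      by apply: cvgB => //; exact: cvg_cst.
    have := st tab; apply: cvg_trans; apply: near_eq_cvg.
    have /cvgrPdist_le/(_ 1 ltr01) := st tab.
    apply: filterS => n fs; rewrite /u mem_set//= /A/= -ht.
    rewrite -(subrK (f t) (s n t)) addrC (le_trans (ler_normD _ _))//.
    by rewrite lerD2l distrC.
  by rewrite expr0n.
- apply: ae_imply2 fh kae => t fh kt n tab.
  rewrite gee0_abs ?lee_fin ?sqr_ge0// -kt//.
  have hu : `|f t - u n t| <= 2 * h t + 1.
    rewrite /u; case: ifPn => [/set_mem/=|_]; last first.
      by rewrite subr0 fh// ler_wpDr// ler_peMl ?h0// ler1n.
    rewrite /A/= => sh; rewrite (le_trans (ler_normB _ _))// fh//; lra.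
  apply: (@le_trans _ _ ((2 * h t + 1) ^+ 2)).
    by rewrite ler_sqr ?nnegrE// (le_trans _ hu).
  by have := sqr_ge0 (2 * h t - 1); lra.
move=> _ _; rewrite integral0 => /(cvge0_lt e0)[n _ /(_ n (leqnn n)) /= kn].
by exists (u n) => //; case: (kP n) => _ _ _ ->; exact: ltW.
Qed.

Lemma L2_continuous_dense a b f : L2 a b f -> L2_approximable a b f.
Proof.
move=> L2f e e0; have e40 : 0 < e / 4 by rewrite divr_gt0.
have [s ss fs] := L2_simple_approx L2f e40.
have [u cu su] := L2_approximable_simple a b ss e40.
exists u => //.
have := L2_sqnorm_triangle L2f.1 (simple_strongly_measurable a b ss)
  (continuous_strongly_measurable a b cu).
move=> /le_trans; apply.
apply: (@le_trans _ _ (2%:E * (e / 4)%:E + 2%:E * (e / 4)%:E)%E).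
  by apply: leeD; rewrite lee_pmul2l// lte_fin.
by rewrite -!EFinM -EFinD lee_fin; lra.
Qed.

End Density.

(** * The estimate for continuous functions *)

Lemma weighted_cauchy_schwarz (R : realFieldType) (c x : nat -> R) (n : nat) :
  (forall k, (k < n)%N -> 0 <= c k) ->
  (\sum_(0 <= k < n) c k * x k) ^+ 2 <=
    (\sum_(0 <= k < n) c k) * \sum_(0 <= k < n) c k * x k ^+ 2.
Proof.
elim: n => [|n IH] c0; first by rewrite !big_geq// expr0n mul0r.
have {}IH := IH (fun k kn => c0 k (ltnW kn)).
rewrite !big_nat_recr//=.
have C0 : 0 <= \sum_(0 <= k < n) c k.
  by rewrite big_nat sumr_ge0// => k kn; rewrite c0// ltnW.
have B0 : 0 <= \sum_(0 <= k < n) c k * x k ^+ 2.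
  by rewrite big_nat sumr_ge0// => k kn; rewrite mulr_ge0 ?sqr_ge0// c0// ltnW.
have {}c0 := c0 n (leqnn _).
move: C0 B0 c0 IH; move: (\sum_(_ <= _ < _) c _) (\sum_(_ <= _ < _) c _ * x _).
move: (\sum_(_ <= _ < _) _) (c n) (x n) => B d y C A C0 B0 d0 ACB.
(* With [C], [A], [B] the three sums so far, the induction step is this inequality times the weight
   [d]. For [C > 0] it follows from [(C y - A)^2 >= 0] and [A^2 <= C B]; for [C = 0] also
   [A = 0]. *)
suff : 2 * A * y <= C * y ^+ 2 + B.
  by move=> /(ler_wpM2l d0); nra.
have [C_eq0|C_neq0] := eqVneq C 0.
  have A0 : A = 0.
    by apply/eqP; rewrite -sqrf_eq0 eq_le sqr_ge0 andbT (le_trans ACB)// C_eq0 mul0r.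
  by rewrite A0 C_eq0 mulr0 !mul0r add0r.
have Cp : 0 < C by rewrite lt_def C_neq0.
rewrite -(ler_pM2l Cp).
have := sqr_ge0 (C * y - A); nra.
Qed.

Section Shift.
Context {R : realType}.
Local Notation mu := (@lebesgue_measure R).

(** Uniqueness of Lebesgue measure reduces the claim to the lengths of half-open intervals. *)
Lemma lebesgue_measure_shift (c : R) (A : set R) : measurable A ->
  pushforward mu (fun t : R => t + c : measurableTypeR R) A = mu A.
Proof.
have mc : measurable_fun setT (fun t : R => t + c : measurableTypeR R).
  by apply: measurable_funD.
move=> mA; apply/esym/lebesgue_measure_unique => //= _ [[a b]] _ <-.
rewrite /pushforward (_ : _ @^-1` _ = `]a - c, b - c]%classic).
  rewrite !lebesgue_measure_itv/= !lte_fin ltrD2r.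
  by case: ifPn => // _; rewrite -!EFinB; congr EFin; ring.
by apply/seteqP; split => t /=; rewrite !in_itv/= ltrBlDr lerBrDr.
Qed.

Lemma ge0_integral_shift (c : R) (D : set R) (f : R -> \bar R) :
  measurable D -> measurable_fun D f -> (forall t, D t -> 0 <= f t)%E ->
  (\int[mu]_(t in (fun t => t + c)%R @^-1` D) f (t + c)%R = \int[mu]_(t in D) f t)%E.
Proof.
move=> mD mf f0.
pose phi : measurableTypeR R -> measurableTypeR R := fun t => t + c.
have mphi : measurable_fun setT phi by apply: measurable_funD.
have fD0 : {in D, forall t, 0 <= f t}%E by move=> t /set_mem; exact: f0.
have := ge0_integral_pushforward mphi mu mD mf fD0.
move=> <-; apply: eq_measure_integral => A mA _.
by rewrite -[RHS](lebesgue_measure_shift c mA).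
Qed.

Lemma L2_sqnorm_shift (V : completeNormedModType R) (a b a' b' c : R) (u : R -> V) :
  continuous u -> a <= a' + c -> b' + c <= b ->
  (L2_sqnorm a' b' (fun t => u (t + c)%R) <= L2_sqnorm a b u)%E.
Proof.
move=> cu ac bc.
have mu2 : measurable_fun `[a, b] (fun t => (`|u t| ^+ 2)%:E).
  apply: measurable_funTS; apply/measurable_EFinP; apply: measurable_funX.
  by apply: continuous_measurable_fun => t; apply: cvg_norm; exact: cu.
rewrite /L2_sqnorm -[leRHS](ge0_integral_shift c)//.
apply: ge0_le_integral_subset; last by move=> t _; rewrite lee_fin sqr_ge0.
move=> t /=; rewrite !in_itv/= => /andP[at_ tb]; apply/andP; split.
  by rewrite (le_trans ac)// lerD2r.
by rewrite (le_trans _ bc)// lerD2r.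
Qed.

End Shift.

(** * Operator norms, fine partitions and bounds on Riemann sums *)

Section OperatorNorm.
Context {R : realType} {X Z : completeNormedModType R}.

(** The supremum that defines [opnorm] carries information only for a bounded set; continuity of [L]
    provides the bound. *)
Let opnorm_has_ubound (L : {linear Z -> X}) : continuous L ->
  has_ubound [set `|L z| | z in [set z | `|z| <= 1]].
Proof.
move=> cL.
have /linear_boundedP/pinfty_ex_gt0[c c0 Lc] : bounded_near L (nbhs (0 : Z)).
  by apply: continuous_linear_bounded; exact: cL.
exists c => _ [v /= v1 <-]; rewrite (le_trans (Lc v))//.
by rewrite -[leRHS]mulr1 ler_pM2l.
Qed.

Lemma opnorm_bound (L : {linear Z -> X}) (z : Z) :
  continuous L -> `|L z| <= opnorm L * `|z|.
Proof.
move=> /opnorm_has_ubound ub.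
have [->|z0] := eqVneq z 0; first by rewrite linear0 !normr0 mulr0.
have nz : 0 < `|z| by rewrite normr_gt0.
rewrite -ler_pdivrMr//; apply: ub_le_sup => //; exists (`|z|^-1 *: z) => /=.
  by rewrite normrZ normfV normr_id mulVf ?gt_eqF.
by rewrite linearZ normrZ normfV normr_id mulrC.
Qed.

Lemma opnorm_ge0 (L : {linear Z -> X}) : continuous L -> 0 <= opnorm L.
Proof.
move=> /opnorm_has_ubound ub; apply: ub_le_sup => //.
by exists 0; rewrite /= ?linear0 normr0.
Qed.

End OperatorNorm.

Lemma exists_fine_partition (R : realType) (a b delta : R) : a <= b -> 0 < delta ->
  exists s xi, itv_partition a b s /\ tagged_mesh a b s xi delta.
Proof.
move=> + d0; rewrite le_eqVlt => /predU1P[<-|ab].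
  (* Partitions have strictly increasing nodes, so a degenerate interval has only the empty one.
     Otherwise [N] equal pieces shorter than [delta] are taken, tagged at their left ends. *)
  by exists [::], (fun=> a); split.
pose N := (Num.trunc ((b - a) / delta)).+1.
have N0 : 0 < N%:R :> R by rewrite ltr0n.
pose p (k : nat) : R := a + (b - a) * (k%:R / N%:R).
pose s := [seq p k.+1 | k <- iota 0 N].
have sN : size s = N by rewrite size_map size_iota.
have nodeE k : (k <= N)%N -> node a b s k = p k.
  case: k => [_|k kN]; first by rewrite /node /p /= mul0r mulr0 addr0.
  by rewrite /node /= (nth_map 0%N) ?size_iota// nth_iota.
have dp k : p k.+1 - p k = (b - a) / N%:R.
  by rewrite /p -natr1; field; rewrite gt_eqF.
have pS k : p k < p k.+1 by rewrite -subr_gt0 dp divr_gt0// subr_gt0.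
exists s, (node a b s); split.
  split.
    apply/(pathP b) => i; rewrite sN => iN.
    by rewrite -[nth b s i]/(node a b s i.+1) -/(node a b s i) !nodeE// ltnW.
  rewrite (last_nth b) sN -/(node a b s N) nodeE// /p divff ?(gt_eqF N0)//.
  by rewrite mulr1 addrC subrK.
move=> n; rewrite sN => nN; rewrite !nodeE ?(ltnW nN)// lexx ltW//= dp; split => //.
rewrite ltr_pdivrMr// mulrC -ltr_pdivrMr//; exact: truncnS_gt.
Qed.

Lemma continuous_sum_nat (R : realType) (X : normedModType R) (f : nat -> R -> X) m :
  (forall k, (k < m)%N -> continuous (f k)) ->
  continuous (fun t => \sum_(0 <= k < m) f k t).
Proof.
elim: m => [|m IH] cf t.
  by under eq_fun do rewrite big_geq//; exact: cvg_cst.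
rewrite (_ : (fun _ => _) = fun t => \sum_(0 <= k < m) f k t + f m t); last first.
  by apply/funext => x; rewrite big_nat_recr.
by apply: cvgD; [apply: IH => k km; apply: cf; exact: ltnW|exact: cf].
Qed.

Section SegmentOperator.
Context {R : realType} {X Z : completeNormedModType R}.
Context (r : R) (eta : R -> {linear Z -> X}) (F : (R -> Z) -> X).
Context (hr : 0 <= r) (hF : bounded_linear_on_C (- r) 0 F)
  (heta : forall theta, theta \in `[- r, 0] -> continuous (eta theta))
  (hBV : op_bounded_variation (- r) 0 eta)
  (hrep : forall phi, continuous_on (- r) 0 phi ->
     is_stieltjes_integral (- r) 0 eta phi (F phi)).
Implicit Types (u v : R -> Z) (s : seq R).

Lemma segment_continuous u (t : R) : continuous u -> continuous (segment u t).
Proof.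
move=> cu x; apply: (@continuous_comp _ _ _ (fun h => t + h) u); last exact: cu.
by apply: cvgD; [exact: cvg_cst|exact: cvg_id].
Qed.

Lemma segment_continuous_on u (t : R) : continuous u ->
  continuous_on (- r) 0 (segment u t).
Proof. by move=> cu; apply: continuous_subspaceT; exact: segment_continuous. Qed.

(** The bound [e] is pointwise on [[- r, 0]], so that [e = 0] shows that [F] does not see the values
    of its argument elsewhere. *)
Lemma operator_lipschitz : exists2 M : R, 0 <= M &
  forall f g (e : R), continuous_on (- r) 0 f -> continuous_on (- r) 0 g ->
    (forall theta, theta \in `[- r, 0] -> `|f theta - g theta| <= e) ->
    `|F f - F g| <= M * e.
Proof.
have [lF [M FM]] := hF; exists `|M| => // f g e cf cg fg.
have cgf : continuous_on (- r) 0 (fun t => (-1) *: g t + f t).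
  move=> t; apply: cvgD; last exact: cf.
  by apply: cvgZr; exact: cg.
have := FM _ cgf; rewrite lF// scaleN1r addrC => /le_trans; apply.
have r0 : 0 \in `[- r, 0] by rewrite in_itv/= lexx oppr_le0 hr.
set S := sup_norm _ _ _.
have Se : S <= e.
  apply: ge_sup; first by exists `|(-1) *: g 0 + f 0|, 0.
  by move=> _ [t tr <-] /=; rewrite scaleN1r addrC fg.
have S0 : 0 <= S.
  apply: (@le_trans _ _ `|(-1) *: g 0 + f 0|) => //.
  apply: ub_le_sup; last by exists 0.
  by exists e => _ [t tr <-] /=; rewrite scaleN1r addrC fg.
apply: (@le_trans _ _ (`|M| * S)); first by rewrite ler_wpM2r// ler_norm.
by rewrite ler_wpM2l.
Qed.

Lemma operator_segment_continuous u : continuous u ->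
  continuous (fun t => F (segment u t)).
Proof.
move=> cu t; have [M M0 FM] := operator_lipschitz.
have M1 : 0 < M + 1 by rewrite ltr_wpDl.
apply/cvgrPdist_le => e e0.
(* The points [t + h] with [h] in [[- r, 0]] fill [[t - r, t]], and passing to time [t'] shifts all
   of them by [t' - t]. The divisor is [M + 1] since [M] may vanish. *)
have /= := continuous_shift_near (t - r) t cu (divr_gt0 e0 M1).
move=> /nbhs_ballP[/= d d0 ud].
apply/nbhs_ballP; exists d => //= t' tt'.
have Fe : `|F (segment u t) - F (segment u t')| <= M * (e / (M + 1)).
  apply: FM; try exact: segment_continuous_on.
  move=> h; rewrite in_itv/= => /andP[rh h0]; rewrite /segment distrC ltW//.
  have -> : t' + h = (t + h) + (t' - t) by ring.
  apply: ud; first by rewrite /ball/= sub0r opprB.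
  by rewrite in_itv/=; apply/andP; split; lra.
rewrite (le_trans Fe)// mulrA ler_pdivrMr// mulrC ler_pM2l//; lra.
Qed.

Lemma increment_linear s n :
  increment (- r) 0 eta s n =
    (eta (node (- r) 0 s n.+1) \- eta (node (- r) 0 s n) : {linear Z -> X}).
Proof. by []. Qed.

Lemma node_itv s n : itv_partition (- r) 0 s -> (n <= size s)%N ->
  node (- r) 0 s n \in `[- r, 0].
Proof.
move=> ps ns; rewrite in_itv/=; apply/andP; split.
  exact: (itv_partition_nth_ge _ ps).
exact: (itv_partition_nth_le _ ps).
Qed.

Lemma increment_continuous s n : itv_partition (- r) 0 s -> (n < size s)%N ->
  continuous (increment (- r) 0 eta s n).
Proof.
move=> ps ns z; apply: cvgB; apply: heta; apply: node_itv => //; exact: ltnW.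
Qed.

(** The operator norms of the increments are the weights, so their sum is the variation; unweighted
    Cauchy-Schwarz would bring in the number of intervals. *)
Lemma riemann_sum_sqr_le s (w : nat -> Z) : itv_partition (- r) 0 s ->
  `|\sum_(0 <= n < size s) increment (- r) 0 eta s n (w n)| ^+ 2 <=
    op_variation (- r) 0 eta s *
    \sum_(0 <= n < size s) opnorm (increment (- r) 0 eta s n) * `|w n| ^+ 2.
Proof.
move=> ps; apply: le_trans; last first.
  apply: weighted_cauchy_schwarz => n ns.
  by rewrite increment_linear opnorm_ge0//; exact: increment_continuous.
rewrite ler_sqr ?nnegrE//; last first.
  rewrite big_nat sumr_ge0// => n ns; rewrite mulr_ge0// increment_linear opnorm_ge0//.
  by apply: increment_continuous.
rewrite (le_trans (ler_norm_sum _ _ _))//.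
rewrite big_nat [leRHS]big_nat; apply: ler_sum => n ns.
rewrite increment_linear; apply: opnorm_bound.
exact: increment_continuous.
Qed.

Lemma riemann_sum_L2 (T : R) s (xi : nat -> R) (delta V : R) u :
  continuous u -> itv_partition (- r) 0 s -> tagged_mesh (- r) 0 s xi delta ->
  op_variation (- r) 0 eta s <= V ->
  (L2_sqnorm 0 T (fun t => (\sum_(0 <= n < size s)
       increment (- r) 0 eta s n (segment u t (xi n)))%R) <=
     (V ^+ 2)%:E * L2_sqnorm (- r) T u)%E.
Proof.
move=> cu ps txi sV.
pose c n := opnorm (increment (- r) 0 eta s n).
have c0 n : (n < size s)%N -> 0 <= c n.
  by move=> ns; rewrite /c increment_linear opnorm_ge0//; exact: increment_continuous.
have V0 : 0 <= op_variation (- r) 0 eta s.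
  by rewrite /op_variation big_nat sumr_ge0// => n ns; exact: c0.
have mu2 (x : R) : measurable_fun `[0, T] (fun t => (`|u (t + x)| ^+ 2)%:E).
  apply: measurable_funTS; apply/measurable_EFinP; apply: measurable_funX.
  apply: continuous_measurable_fun => t; apply: cvg_norm.
  apply: (@continuous_comp _ _ _ (fun h => h + x) u); last exact: cu.
  by apply: cvgD; [exact: cvg_id|exact: cvg_cst].
have w0 (i : 'I_(size s)) : 0 <= V * c i by rewrite mulr_ge0 ?c0// (le_trans V0).
apply: (@le_trans _ _ (\int[lebesgue_measure]_(t in `[0%R, T])
    (\sum_(i < size s) ((V * c i)%:E * (`|u (t + xi i)%R| ^+ 2)%:E))%E)%E).
  apply: ae_ge0_le_integral.
  - by move=> t _; rewrite lee_fin sqr_ge0.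
  - move=> t _; apply: sume_ge0 => i _.
    by rewrite -EFinM lee_fin mulr_ge0 ?sqr_ge0.
  apply: aeW => t _.
  under [leRHS]eq_bigr => i _ do rewrite -EFinM.
  rewrite sumEFin lee_fin (le_trans (riemann_sum_sqr_le _ ps))// big_mkord.
  apply: (@le_trans _ _ (V * \sum_(i < size s) c i * `|u (t + xi i)| ^+ 2)).
    by rewrite ler_wpM2r// sumr_ge0// => i _; rewrite mulr_ge0 ?sqr_ge0// c0.
  by rewrite mulr_sumr; apply: ler_sum => i _; rewrite mulrA.
rewrite ge0_integral_sum//; last 2 first.
- by move=> i; apply: measurable_funeM; exact: mu2.
- by move=> i t _; rewrite -EFinM lee_fin mulr_ge0 ?sqr_ge0.
(* Tags lie between nodes of [[- r, 0]], so translating [[0, T]] by a tag stays inside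
   [[- r, T]]. *)
have xi_itv (i : 'I_(size s)) : - r <= xi i <= 0.
  have /andP[xl xr] := (txi i (ltn_ord i)).1.
  have := node_itv ps (ltn_ord i); have := node_itv ps (ltnW (ltn_ord i)).
  rewrite !in_itv/= => /andP[nl _] /andP[_ nr].
  by rewrite (le_trans nl xl) (le_trans xr nr).
apply: (@le_trans _ _ (\sum_(i < size s) ((V * c i)%:E * L2_sqnorm (- r) T u))%E).
  apply: lee_sum => i _; rewrite ge0_integralZl ?lee_fin//; last exact: mu2.
  apply: lee_wpmul2l; first by rewrite lee_fin.
  have /andP[xl xr] := xi_itv i.
  by apply: L2_sqnorm_shift; rewrite ?add0r// gerDl.
rewrite -ge0_sume_distrl; last by move=> i _; rewrite lee_fin.
apply: lee_wpmul2r; first exact: L2_sqnorm_ge0.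
(* The first factor [V] came from Cauchy-Schwarz; the second arises here, as the [c i] sum to the
   variation again. *)
rewrite sumEFin lee_fin -mulr_sumr expr2 ler_wpM2l//; first exact: le_trans sV.
by apply: le_trans sV; rewrite /op_variation big_mkord.
Qed.

Lemma operator_segment_L2 (T : R) : exists2 C : R, 0 < C &
  forall u, continuous u ->
    (L2_sqnorm 0 T (fun t => F (segment u t)) <= C%:E * L2_sqnorm (- r) T u)%E.
Proof.
(* The summand 1 makes the constant positive also when [V = 0]. *)
have [V VP] := hBV; exists (V ^+ 2 + 1) => [|u cu]; first by rewrite ltr_wpDl ?sqr_ge0.
have r0 : - r <= 0 by rewrite oppr_le0.
have /choice[s /choice[xi sxi]] n : exists s xi,
    itv_partition (- r) 0 s /\ tagged_mesh (- r) 0 s xi n.+1%:R^-1.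
  by apply: exists_fine_partition => //; rewrite invr_gt0 ltr0n.
pose S n t := \sum_(0 <= k < size (s n))
  increment (- r) 0 eta (s n) k (segment u t (xi n k)).
have Scont n : continuous (S n).
  apply: continuous_sum_nat => k ks t.
  have ck := increment_continuous (sxi n).1 ks.
  apply: (@continuous_comp _ _ _ (fun h => segment u h (xi n k))); last exact: ck.
  apply: (@continuous_comp _ _ _ (fun h => h + xi n k) u); last exact: cu.
  by apply: cvgD; [exact: cvg_id|exact: cvg_cst].
apply: (@L2_sqnorm_fatou _ _ _ _ S _ (fun=> ((V ^+ 2 + 1)%:E * L2_sqnorm (- r) T u)%E)).
- by move=> n; exact: continuous_strongly_measurable.
- apply: aeW => t _; apply/cvgrPdist_lt => e e0.
  have [d d0 dF] := hrep (@segment_continuous_on u t cu) e0.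
  have /cvgrPdist_lt/(_ d d0) := @cvg_harmonic R.
  apply: filterS => n; rewrite sub0r normrN ger0_norm ?invr_ge0// => nd.
  have [ps ts] := sxi n; rewrite distrC; apply: dF => // k ks.
  by have [? kn] := ts k ks; split => //; exact: lt_trans nd.
- move=> n; have [ps ts] := sxi n.
  apply: (@le_trans _ _ ((V ^+ 2)%:E * L2_sqnorm (- r) T u)%E).
    apply: (@riemann_sum_L2 T (s n) (xi n) _ V u) => //; first exact: ts.
    by apply: VP; exists (s n).
  by apply: lee_wpmul2r; [exact: L2_sqnorm_ge0|rewrite lee_fin lerDl].
- exact: cvg_cst.
Qed.

End SegmentOperator.

(** * Extension to L^2 *)

Section FastCauchy.
Context {R : realType} {V : completeNormedModType R}.
Local Notation mu := (@lebesgue_measure R).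

(** The differences form a series dominated in norm by a geometric one, which converges by
    completeness. *)
Lemma cvgn_summable_diff (u : nat -> V) (M : R) : 0 <= M ->
  (forall n, `|u n.+1 - u n| <= M / 2 ^+ n) -> cvgn u.
Proof.
move=> M0 uM.
have : cvgn (series (telescope u)).
  apply: normed_cvg; apply: (@series_le_cvg _ _ (geometric M (2^-1))) => //.
  - by move=> n; exact: normr_ge0.
  - by move=> n; rewrite mulr_ge0 ?exprn_ge0 ?invr_ge0.
  - by move=> n; rewrite /= exprVn; exact: uM.
  - by apply: is_cvg_geometric_series; rewrite gtr0_norm ?invr_gt0// invf_lt1// ltr1n.
rewrite telescopeK => cu.
rewrite (_ : u = fun n => u n - u 0%N + u 0%N); last by apply/funext => n; rewrite subrK.
by apply: is_cvgD => //; exact: is_cvg_cst.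
Qed.

(* The weights [4 ^+ n] keep [\sum_n 4 ^+ n * `|g n.+1 t - g n t| ^+ 2] integrable. *)
Lemma L2_fast_cauchy_ae_cvg (a b K : R) (g : nat -> R -> V) : 0 <= K ->
  (forall n, continuous (g n)) ->
  (forall n, (L2_sqnorm a b (fun t => g n.+1 t - g n t)%R <=
              (K / (4 ^+ n * (2 ^ n.+1)%:R))%:E)%E) ->
  \forall t \ae mu, t \in `[a, b] -> cvgn (g^~ t).
Proof.
move=> K0 cg gK.
pose f n t := ((4 ^+ n * `|g n.+1 t - g n t| ^+ 2)%:E : \bar R).
have f0 n t : (0 <= f n t)%E by rewrite lee_fin mulr_ge0 ?exprn_ge0 ?sqr_ge0.
have mg n : measurable_fun `[a, b] (fun t => (`|g n.+1 t - g n t| ^+ 2)%:E).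
  apply: measurable_funTS; apply/measurable_EFinP; apply: measurable_funX.
  apply: continuous_measurable_fun => t; apply: cvg_norm.
  by apply: cvgB; exact: cg.
have fE n : f n = fun t => ((4 ^+ n)%:E * (`|g n.+1 t - g n t| ^+ 2)%:E)%E by [].
have mf n : measurable_fun `[a, b] (f n) by rewrite fE; exact: measurable_funeM.
have intf : (\int[mu]_(t in `[a, b]) (\sum_(n <oo) f n t) <= K%:E)%E.
  rewrite integral_nneseries//.
  (* [epsilon_trick0] bounds the sum of [K / 2 ^ n.+1] by [K]; this is the purpose of the power of 2
     in the hypothesis. *)
  apply: le_trans (@epsilon_trick0 _ K xpredT K0).
  apply: lee_nneseries => [n _ _|n _]; first exact: integral_ge0.
  rewrite fE ge0_integralZl ?lee_fin ?exprn_ge0//; last exact: mg.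
  apply: (@le_trans _ _ ((4 ^+ n)%:E * (K / (4 ^+ n * (2 ^ n.+1)%:R))%:E)%E).
    by apply: lee_wpmul2l; [rewrite lee_fin exprn_ge0|exact: gK].
  rewrite -EFinM lee_fin le_eqVlt; apply/orP; left; apply/eqP; field.
  by rewrite pnatr_eq0 -lt0n expn_gt0/= expf_neq0// pnatr_eq0.
have sint : mu.-integrable `[a, b] (fun t => \sum_(n <oo) f n t)%E.
  apply/integrableP; split; first exact: (@ge0_emeasurable_sum _ _ _ _ f xpredT).
  under eq_integral do rewrite gee0_abs ?nneseries_ge0//.
  by rewrite (le_lt_trans intf)// ltry.
apply: ae_imply (integrable_ae _ sint) => // t ft tab.
have {}ft := ft tab; set M := (\sum_(n <oo) f n t)%E in ft.
have M0 : 0 <= fine M by rewrite fine_ge0// nneseries_ge0.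
(* The term of index [n] is at most [M], so the difference is at most [sqrt M / 2 ^+ n]; [M + 1]
   bounds [sqrt M] without taking a root. *)
apply: (@cvgn_summable_diff _ (fine M + 1)) => [|n]; first by rewrite addr_ge0.
have : (f n t <= M)%E.
  apply: le_trans (nneseries_lim_ge n.+1 _) => //.
  by rewrite big_nat_recr//= leeDr// sume_ge0.
rewrite -(fineK ft) lee_fin => fM.
rewrite -ler_sqr ?nnegrE ?divr_ge0 ?exprn_ge0 ?addr_ge0//.
rewrite expr_div_n -exprM mulnC exprM (_ : 2 ^+ 2 = 4); last by rewrite expr2; ring.
rewrite ler_pdivlMr ?exprn_gt0// mulrC (le_trans fM)//.
by have := sqr_ge0 (fine M); nra.
Qed.

End FastCauchy.

Section Extension.
Context {R : realType} {X Z : completeNormedModType R}.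
Context (a b c d C : R) (G : (R -> Z) -> R -> X).
Context (C0 : 0 <= C)
  (G_continuous : forall u, continuous u -> continuous (G u))
  (G_lin : forall (k : R) u v, continuous u -> continuous v ->
     G (fun t => k *: u t + v t) = (fun t => k *: G u t + G v t))
  (G_bounded : forall u, continuous u ->
     (L2_sqnorm c d (G u) <= C%:E * L2_sqnorm a b u)%E).
Implicit Types (u v y : R -> Z).

Let GB u v : continuous u -> continuous v ->
  G (fun t => u t - v t) = (fun t => G u t - G v t).
Proof.
move=> cu cv; rewrite (_ : (fun t => u t - v t) = (fun t => (-1) *: v t + u t)).
  by rewrite G_lin//; apply/funext => t; rewrite scaleN1r addrC.
by apply/funext => t; rewrite scaleN1r addrC.
Qed.

Let continuousB u v : continuous u -> continuous v -> continuous (fun t => u t - v t).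
Proof. by move=> cu cv t; apply: cvgB; [exact: cu|exact: cv]. Qed.

(** The inequality is stated for every [v] because it serves several times: [v = 0] gives the norm
    estimate, [v] close to [y] gives linearity, and [v] equal to [y] on the interval gives the
    extension property. *)
Lemma L2_continuous_extension : exists Phi : (R -> Z) -> R -> X,
  forall y, L2 a b y -> strongly_measurable c d (Phi y) /\
    forall v, continuous v ->
      (L2_sqnorm c d (fun t => Phi y t - G v t)%R <=
         (2 * C)%:E * L2_sqnorm a b (fun t => y t - v t)%R)%E.
Proof.
have /choice[u uP] (y : R -> Z) : exists u : nat -> R -> Z, L2 a b y ->
    forall n, continuous (u n) /\
      (L2_sqnorm a b (fun t => y t - u n t)%R <= ((8 ^+ n)^-1)%:E)%E.
  (* [choice] requires a sequence for every [y]; outside L^2 a constant one is a default. *)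
  have [L2y|nL2y] := pselect (L2 a b y); last by exists (fun=> y).
  suff /choice[u uP] n : exists v, continuous v /\
      (L2_sqnorm a b (fun t => y t - v t)%R <= ((8 ^+ n)^-1)%:E)%E by exists u.
  have n0 : 0 < (8 ^+ n)^-1 :> R by rewrite invr_gt0 exprn_gt0.
  by have [v cv yv] := L2_continuous_dense L2y n0; exists v.
exists (fun y t => lim (G (u y n) t @[n --> \oo])) => y L2y.
have {}uP := uP y L2y; move: (u y) uP => {}u uP.
have cu n := (uP n).1; have yu n := (uP n).2.
have mu_ n := continuous_strongly_measurable a b (cu n).
have Gae : \forall t \ae (@lebesgue_measure R), t \in `[c, d] ->
    G (u n) t @[n --> \oo] --> lim (G (u n) t @[n --> \oo]).
  (* The squared norm of [u n.+1 - u n] is at most [2 / 8 ^+ n.+1 + 2 / 8 ^+ n <= 4 / 8 ^+ n]. The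
     rate [8 ^+ n] is [4 ^+ n * 2 ^+ n], weight times summable factor; the exponent in [2 ^ n.+1]
     turns [4 * C] into [8 * C]. *)
  apply: (@L2_fast_cauchy_ae_cvg _ _ c d (8 * C) (fun n => G (u n))) => //.
  - by rewrite mulr_ge0.
  - by move=> n; exact: G_continuous.
  move=> n; rewrite -GB//; apply: (le_trans (G_bounded (continuousB (cu n.+1) (cu n)))).
  apply: (@le_trans _ _ (C%:E * (2 / 8 ^+ n.+1 + 2 / 8 ^+ n)%:E)%E).
    apply: lee_wpmul2l; first by rewrite lee_fin.
    apply: (le_trans (L2_sqnorm_triangle (mu_ n.+1) L2y.1 (mu_ n))).
    rewrite [leRHS]EFinD; apply: leeD; rewrite [leRHS]EFinM; apply: lee_wpmul2l => //.
    by rewrite L2_sqnormBC.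
  rewrite -EFinM lee_fin.
  have n8 : 8 ^+ n != 0 :> R by rewrite expf_neq0// pnatr_eq0.
  have -> : 8 * C / (4 ^+ n * (2 ^ n.+1)%:R) = C * (4 / 8 ^+ n).
    rewrite natrX exprS (_ : 4 ^+ n * _ = 2 * 8 ^+ n); first by field.
    by rewrite mulrCA -exprMn; congr (2 * _ ^+ _); ring.
  apply: ler_wpM2l => //; rewrite exprS invfM.
  have : 0 <= (8 ^+ n)^-1 :> R by rewrite invr_ge0 exprn_ge0.
  lra.
split; first exact: (strongly_measurable_cvg (fun n => G_continuous (cu n)) Gae).
move=> v cv.
(* Bound for [G (u n) - G v] obtained by passing through [y]; its first term vanishes in the
   limit. *)
pose e n : \bar R := ((2 * C / 8 ^+ n)%:E +
  (2 * C)%:E * L2_sqnorm a b (fun t => y t - v t)%R)%E.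
apply: (@L2_sqnorm_fatou _ _ c d (fun n t => G (u n) t - G v t) _ e).
- move=> n; rewrite -GB//; apply: continuous_strongly_measurable.
  by apply: G_continuous; exact: continuousB.
- apply: ae_imply Gae => t Gt tcd; apply: cvgB; first exact: Gt.
  exact: cvg_cst.
- move=> n; rewrite -GB//; apply: (le_trans (G_bounded (continuousB (cu n) cv))).
  have := L2_sqnorm_triangle (mu_ n) L2y.1 (continuous_strongly_measurable a b cv).
  move=> /(lee_wpmul2l (_ : 0 <= C%:E)%E) => /(_ _)/le_trans; apply.
    by rewrite lee_fin.
  rewrite ge0_muleDr ?mule_ge0 ?L2_sqnorm_ge0//.
  rewrite /e !muleA -!EFinM (mulrC C 2); apply: leeD => //.
  rewrite [leRHS]EFinM; apply: lee_wpmul2l; first by rewrite lee_fin mulr_ge0.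
  by rewrite L2_sqnormBC.
- rewrite -[X in _ --> X]add0e; apply: cvgeD => //; last exact: cvg_cst.
  apply: cvg_EFin; first exact: nearW.
  rewrite (_ : _ \o _ = geometric (2 * C) 8^-1).
    by apply: cvg_geometric; rewrite gtr0_norm ?invr_gt0// invf_lt1// ltr1n.
  by apply/funext => n; rewrite /= exprVn.
Qed.

End Extension.

Section L2Facts.
Context {R : realType} {V : completeNormedModType R}.
Implicit Types (a b : R) (f g : R -> V).

Lemma L2_sqnorm_lin_le a b (k m : R) f g :
  strongly_measurable a b f -> strongly_measurable a b g ->
  (L2_sqnorm a b f <= m%:E)%E -> (L2_sqnorm a b g <= m%:E)%E ->
  (L2_sqnorm a b (fun t => k *: f t + g t)%R <= ((2 * k ^+ 2 + 2) * m)%:E)%E.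
Proof.
move=> mf mg fm gm.
have mkf : strongly_measurable a b (fun t => k *: f t).
  have := strongly_measurable_lin k mf (simple_strongly_measurable a b (simple_cst (0 : V))).
  by congr strongly_measurable; apply/funext => t; rewrite addr0.
apply: (le_trans (L2_sqnormD mkf mg)); rewrite L2_sqnormZ//.
have -> : ((2 * k ^+ 2 + 2) * m)%:E = (2%:E * ((k ^+ 2)%:E * m%:E) + 2%:E * m%:E)%E.
  by rewrite -!EFinM -EFinD; congr EFin; ring.
apply: leeD; apply: lee_wpmul2l => //.
by apply: lee_wpmul2l => //; rewrite lee_fin sqr_ge0.
Qed.

Lemma L2_lin a b (k : R) f g : L2 a b f -> L2 a b g ->
  L2 a b (fun t => k *: f t + g t).
Proof.
move=> [mf fy] [mg gy]; split; first exact: strongly_measurable_lin.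
have ffin : L2_sqnorm a b f \is a fin_num by rewrite ge0_fin_numE// L2_sqnorm_ge0.
have gfin : L2_sqnorm a b g \is a fin_num by rewrite ge0_fin_numE// L2_sqnorm_ge0.
pose m := Num.max (fine (L2_sqnorm a b f)) (fine (L2_sqnorm a b g)).
have fm : (L2_sqnorm a b f <= m%:E)%E by rewrite -(fineK ffin) lee_fin le_max lexx.
have gm : (L2_sqnorm a b g <= m%:E)%E by rewrite -(fineK gfin) lee_fin le_max lexx orbT.
by apply: le_lt_trans (L2_sqnorm_lin_le k mf mg fm gm) _; rewrite ltry.
Qed.

Lemma continuous_L2 a b f : continuous f -> L2 a b f.
Proof.
move=> cf; split; first exact: continuous_strongly_measurable.
have : (@lebesgue_measure R).-integrable `[a, b] (EFin \o (fun t => `|f t| ^+ 2)).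
  apply: continuous_compact_integrable; first exact: segment_compact.
  apply: continuous_subspaceT => t; rewrite /continuous_at expr2.
  by under eq_fun do rewrite expr2; apply: cvgM; apply: cvg_norm; exact: cf.
move=> /integrableP[_]; apply: le_lt_trans.
rewrite le_eqVlt; apply/orP; left; apply/eqP; apply: eq_integral => t _.
by rewrite gee0_abs// lee_fin sqr_ge0.
Qed.

Lemma strongly_measurable_eq a b f g : L2_eq a b f g ->
  strongly_measurable a b f -> strongly_measurable a b g.
Proof.
move=> fg [s ss sf]; exists s => //; apply: ae_imply2 fg sf => t fg sf tab.
by rewrite -fg//; exact: sf.
Qed.

Lemma L2_sqnorm_small_eq0 a b f : 
  (forall e : R, 0 < e -> (L2_sqnorm a b f <= e%:E)%E) -> L2_sqnorm a b f = 0%E.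
Proof.
move=> fe; apply/eqP; rewrite eq_le L2_sqnorm_ge0 andbT.
by apply/lee_addgt0Pr => e e0; rewrite add0e fe.
Qed.

Lemma L2_sqnormB_eq0 a b f g :
  strongly_measurable a b f -> strongly_measurable a b g ->
  L2_sqnorm a b (fun t => f t - g t) = 0%E -> L2_eq a b f g.
Proof.
move=> mf mg fg0; have := L2_sqnorm_eq0 (strongly_measurableB mf mg) fg0.
by apply: ae_imply => t fg tab; apply/eqP; rewrite -subr_eq0 fg.
Qed.

(** Passes from continuity within [[a, b]] to continuity on R; by [clamp_id] the values on [[a, b]]
    are unchanged. *)
Lemma continuous_on_clamp a b f : a <= b -> continuous_on a b f ->
  continuous (f \o clamp a b).
Proof.
move=> ab /subspace_continuousP cf x.
have xab := clamp_itv x ab.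
move=> P /= /(cf _ xab) /= wP.
have : \forall t \near x, clamp a b t \in `[a, b] -> P (f (clamp a b t)).
  exact: (@clamp_continuous R a b x _ wP).
by rewrite nbhs_simpl; apply: filterS => t; apply; exact: clamp_itv.
Qed.

End L2Facts.

Section Uniqueness.
Context {R : realType} {X Z : completeNormedModType R}.

Lemma L2_extension_unique (r T : R) (F : (R -> Z) -> X) (Phi Psi : (R -> Z) -> R -> X) :
  L2_extension r T F Phi -> L2_extension r T F Psi ->
  forall y, L2 (- r) T y -> L2_eq 0 T (Psi y) (Phi y).
Proof.
move=> [Phi2 _ Phic PhiF] [Psi2 _ Psic PsiF] y L2y.
have /choice[u uP] n : exists u, continuous u /\
    (L2_sqnorm (- r) T (fun t => y t - u t)%R <= (n.+1%:R^-1)%:E)%E.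
  have n0 : 0 < n.+1%:R^-1 :> R by rewrite invr_gt0 ltr0n.
  by have [v cv yv] := L2_continuous_dense L2y n0; exists v.
have cu n := (uP n).1; have L2u n := continuous_L2 (- r) T (cu n).
have uy : L2_cvg (- r) T u y.
  apply: (@squeeze_cvge _ _ _ _ (fun=> 0%E) _ (fun n => (n.+1%:R^-1)%:E)).
  - by apply: nearW => n; rewrite L2_sqnorm_ge0/= L2_sqnormBC; exact: (uP n).2.
  - exact: cvg_cst.
  - by apply: cvg_EFin; [exact: nearW|exact: cvg_harmonic].
have mPhi := (Phi2 _ L2y).1; have mPsi := (Psi2 _ L2y).1.
apply: L2_sqnormB_eq0 => //; apply: L2_sqnorm_small_eq0 => e e0.
have e40 : 0 < e / 4 by rewrite divr_gt0.
have := filterI (cvge0_lt e40 (Phic _ _ L2u L2y uy))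
  (cvge0_lt e40 (Psic _ _ L2u L2y uy)).
move=> [n _ /(_ n (leqnn n))[/= Phin Psin]].
have mu_ := (Psi2 _ (L2u n)).1.
apply: (le_trans (L2_sqnorm_triangle mPsi mu_ mPhi)).
apply: (@le_trans _ _ (2%:E * (e / 4)%:E + 2%:E * (e / 4)%:E)%E); last first.
  by rewrite -!EFinM -EFinD lee_fin; lra.
apply: leeD; apply: lee_wpmul2l => //; first by rewrite L2_sqnormBC ltW.
(* [Psi (u n)] and [Phi (u n)] both agree a.e. with [F] along the segments of the continuous [u n],
   so one replaces the other. *)
rewrite (eq_L2_sqnorm (_ : L2_eq _ _ _ (fun t => Phi (u n) t - Phi y t))) ?ltW//.
have cun : continuous_on (- r) T (u n) by exact: continuous_subspaceT.
by apply: ae_imply2 (PhiF _ cun) (PsiF _ cun) => t hPhi hPsi tT; rewrite hPhi// hPsi.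
Qed.

End Uniqueness.

Theorem proposition1p1 (R : realType) (X Z : completeNormedModType R)
  (DA : set X) (A : X -> X) (iota : {linear Z -> X})
  (r : R) (eta : R -> {linear Z -> X}) (F : (R -> Z) -> X)
  (hX : separable X)
  (hA : generates_C0_semigroup DA A)
  (hZ : dense_continuous_embeddings DA A iota)
  (hr : 0 <= r)
  (hF : bounded_linear_on_C (- r) 0 F)
  (heta : forall theta, theta \in `[- r, 0] -> continuous (eta theta))
  (hBV : op_bounded_variation (- r) 0 eta)
  (hrep : forall phi, continuous_on (- r) 0 phi ->
     is_stieltjes_integral (- r) 0 eta phi (F phi))
  (T : R) (hT : 0 <= T) :
  exists Phi : (R -> Z) -> (R -> X),
    [/\ L2_extension r T F Phi,
        forall Psi, L2_extension r T F Psi ->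
          forall y, L2 (- r) T y -> L2_eq 0 T (Psi y) (Phi y),
        forall y, L2 (- r) T y -> L2 0 T (Phi y) &
        exists2 C : R, 0 < C & forall y, L2 (- r) T y ->
          (\int[lebesgue_measure]_(t in `[0%R, T]) (`|Phi y t| ^+ 2)%:E
           <= C%:E * \int[lebesgue_measure]_(t in `[(- r)%R, T])
                       (`|y t| ^+ 2)%:E)%E].
Proof.
have [C C0 FC] := operator_segment_L2 hr heta hBV hrep T.
pose G (u : R -> Z) t := F (segment u t).
have Gc u : continuous u -> continuous (G u).
  exact: (operator_segment_continuous hr hF).
have Glin (k : R) u v : continuous u -> continuous v ->
    G (fun t => k *: u t + v t) = (fun t => k *: G u t + G v t).
  move=> cu cv; apply/funext => t; rewrite /G.
  exact: (hF.1 k _ _ (segment_continuous_on cu) (segment_continuous_on cv)).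
have [Phi PhiP] := L2_continuous_extension (ltW C0) Gc Glin FC.
have mPhi y (L2y : L2 (- r) T y) := (PhiP y L2y).1.
have PhiG y (L2y : L2 (- r) T y) := (PhiP y L2y).2.
have G0 t : G (fun=> 0) t = 0.
  have c0 : continuous (fun _ : R => 0 : Z) by apply: cst_continuous.
  have := Glin (-1) _ _ c0 c0; rewrite (_ : (fun t => -1 *: 0 + 0) = fun=> 0).
    by move=> ->; rewrite scaleN1r addNr.
  by apply/funext => ?; rewrite scaler0 addr0.
have est y : L2 (- r) T y ->
    (L2_sqnorm 0 T (Phi y) <= (2 * C)%:E * L2_sqnorm (- r) T y)%E.
  (* The inequality at [v = 0], where [G] vanishes. *)
  move=> L2y; have := PhiG y L2y (fun=> 0) (@cst_continuous _ _ _).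
  rewrite (_ : (fun t => Phi y t - _) = Phi y); last first.
    by apply/funext => t; rewrite G0 subr0.
  by rewrite (_ : (fun t => y t - _) = y)//; apply/funext => t; rewrite subr0.
have L2Phi y : L2 (- r) T y -> L2 0 T (Phi y).
  move=> L2y; split; first exact: mPhi.
  apply: le_lt_trans (est y L2y) _; apply: lte_mul_pinfty => //; last exact: L2y.2.
  by rewrite lee_fin mulr_ge0// ltW.
have Philin (k : R) y1 y2 : L2 (- r) T y1 -> L2 (- r) T y2 ->
    L2_eq 0 T (Phi (fun t => k *: y1 t + y2 t)) (fun t => k *: Phi y1 t + Phi y2 t).
  move=> L1 L2'; have L12 := L2_lin k L1 L2'.
  apply: L2_sqnormB_eq0; first exact: mPhi.
    by apply: strongly_measurable_lin; exact: mPhi.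
  apply: L2_sqnorm_small_eq0 => e e0.
  pose K := 2 * k ^+ 2 + 2.
  have K0 : 0 < K by rewrite ltr_wpDl// mulr_ge0// sqr_ge0.
  (* [G] is exactly linear on continuous functions, and both sides of the claim are within
     [2 * C * K * d] of [G v] in squared norm, [K] being the constant of [L2_sqnorm_lin_le]. Their
     difference costs a further factor 4. *)
  pose d := e / (4 * (2 * C * K)).
  have d0 : 0 < d by rewrite divr_gt0// !mulr_gt0.
  have [v1 c1 y1d] := L2_continuous_dense L1 d0.
  have [v2 c2 y2d] := L2_continuous_dense L2' d0.
  pose v t := k *: v1 t + v2 t.
  have cv : continuous v.
    by move=> t; apply: cvgD; [apply: cvgZr; exact: c1|exact: c2].
  have smv (w : R -> Z) : continuous w -> strongly_measurable (- r) T w.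
    exact: continuous_strongly_measurable.
  have smG (w : R -> Z) : continuous w -> strongly_measurable 0 T (G w).
    by move=> cw; apply: continuous_strongly_measurable; exact: Gc.
  have Phid y (w : R -> Z) : L2 (- r) T y -> continuous w ->
      (L2_sqnorm (- r) T (fun t => y t - w t)%R <= d%:E)%E ->
      (L2_sqnorm 0 T (fun t => Phi y t - G w t)%R <= (2 * C * d)%:E)%E.
    move=> L2y cw yd; apply: (le_trans (PhiG _ L2y _ cw)).
    by rewrite [leRHS]EFinM; apply: lee_wpmul2l => //; rewrite lee_fin mulr_ge0// ltW.
  have yv : (L2_sqnorm (- r) T (fun t => k *: y1 t + y2 t - v t)%R <= (K * d)%:E)%E.
    have := L2_sqnorm_lin_le k (strongly_measurableB L1.1 (smv _ c1))
      (strongly_measurableB L2'.1 (smv _ c2)) y1d y2d.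
    congr (L2_sqnorm _ _ _ <= _)%E; apply/funext => t.
    by rewrite /v scalerBr opprD addrACA.
  have A1 : (L2_sqnorm 0 T (fun t => Phi (fun t => k *: y1 t + y2 t) t - G v t)%R
      <= (2 * C * K * d)%:E)%E.
    apply: (le_trans (PhiG _ L12 _ cv)); rewrite -mulrA [leRHS]EFinM.
    by apply: lee_wpmul2l => //; rewrite lee_fin mulr_ge0// ltW.
  have A2 : (L2_sqnorm 0 T (fun t => k *: (Phi y1 t - G v1 t) + (Phi y2 t - G v2 t))%R
      <= (2 * C * K * d)%:E)%E.
    have := L2_sqnorm_lin_le k (strongly_measurableB (mPhi _ L1) (smG _ c1))
      (strongly_measurableB (mPhi _ L2') (smG _ c2)) (Phid _ _ L1 c1 y1d) (Phid _ _ L2' c2 y2d).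
    by rewrite -/K mulrA (mulrC K) mulrAC.
  have := L2_sqnorm_lin_le (-1)
    (strongly_measurable_lin k (strongly_measurableB (mPhi _ L1) (smG _ c1))
      (strongly_measurableB (mPhi _ L2') (smG _ c2)))
    (strongly_measurableB (mPhi _ L12) (smG _ cv)) A2 A1.
  rewrite (_ : (2 * (-1) ^+ 2 + 2) * (2 * C * K * d) = e); last first.
    by rewrite /d; field; rewrite !gt_eqF.
  congr (L2_sqnorm _ _ _ <= _)%E; apply/funext => t.
  by rewrite /v Glin// scaleN1r scalerBr addrACA -opprD opprB [LHS]addrC addrA subrK.
have ext : L2_extension r T F Phi.
  split => //.
  - move=> u y L2u L2y uy.
    (* The difference is written in the form of [Philin], so that linearity reduces continuity to
       the norm estimate. *)
    have L2uy n : L2 (- r) T (fun t => (-1) *: y t + u n t) by exact: L2_lin.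
    have E n : L2_sqnorm 0 T (fun t => Phi (u n) t - Phi y t) =
        L2_sqnorm 0 T (Phi (fun t => (-1) *: y t + u n t)).
      apply: eq_L2_sqnorm; apply: ae_imply (Philin (-1) _ _ L2y (L2u n)) => t h tT.
      by rewrite h// scaleN1r addrC.
    apply: (@squeeze_cvge _ _ _ _ (fun=> 0%E) _
      (fun n => (2 * C)%:E * L2_sqnorm (- r) T (fun t => u n t - y t)%R)%E).
    + apply: nearW => n; rewrite L2_sqnorm_ge0/= E (le_trans (est _ (L2uy n)))//.
      rewrite (_ : (fun t => -1 *: y t + u n t) = fun t => u n t - y t)//.
      by apply/funext => t; rewrite scaleN1r addrC.
    + exact: cvg_cst.
    + by rewrite -(mule0 (2 * C)%:E); apply: cvgeZl.
  - move=> y cy.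
    have rT : - r <= T by rewrite (le_trans _ hT)// oppr_le0.
    (* [y] is continuous only within [[- r, T]]. Its replacement [v] is continuous on R and agrees
       with [y] there, so the inequality holds with right-hand side 0. *)
    pose v := y \o clamp (- r) T.
    have cv : continuous v by exact: continuous_on_clamp.
    have vy t : t \in `[- r, T] -> v t = y t by move=> tT; rewrite /v /= clamp_id.
    have L2v := continuous_L2 (- r) T cv.
    have L2y : L2 (- r) T y.
      have vye : L2_eq (- r) T v y by apply: aeW => t; exact: vy.
      split; first exact: strongly_measurable_eq vye L2v.1.
      by rewrite -(eq_L2_sqnorm vye); exact: L2v.2.
    have Phiv : L2_eq 0 T (Phi y) (G v).
      apply: L2_sqnormB_eq0; first exact: mPhi.
        by apply: continuous_strongly_measurable; exact: Gc.
      apply/eqP; rewrite eq_le L2_sqnorm_ge0 andbT (le_trans (PhiG _ L2y _ cv))//.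
      rewrite [X in (_ * X)%E](_ : _ = 0%E) ?mule0//.
      apply: integral0_eq => t tT.
      by rewrite vy// subrr normr0 expr0n.
    apply: ae_imply Phiv => t Phiv tT; rewrite Phiv// /G.
    have vyt h : h \in `[- r, 0] -> segment v t h = segment y t h.
      move: tT; rewrite !in_itv/= => /andP[t0 tT] /andP[rh h0].
      by rewrite /segment vy// in_itv/=; apply/andP; split; lra.
    have cyt : continuous_on (- r) 0 (segment y t).
      apply: subspace_eq_continuous (segment_continuous_on cv).
      by move=> h /set_mem; exact: vyt.
    (* The two segments agree on [[- r, 0]] but may differ elsewhere on R; the Lipschitz bound with
       [e = 0] identifies their images under [F]. *)
    have [M M0 FM] := operator_lipschitz hr hF.
    apply/eqP; rewrite -subr_eq0 -normr_le0 -(mulr0 M); apply: FM => //.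
      exact: segment_continuous_on.
    by move=> h hr0; rewrite vyt// subrr normr0.
exists Phi; split => //.
- by move=> Psi extPsi; exact: (L2_extension_unique ext extPsi).
- by exists (2 * C); [rewrite mulr_gt0|].
Qed.
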